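(* Let $Y\in\mathbb{C}^{(n\times n)\cdot d}$ and let $f$ be an NC function that is uniformly analytic in a uniformly open neighbourhood of $Y$. Then $f$ has a matrix-centre realization at $Y$: there exist a Hilbert space $\mathcal{H}$, linear maps $A_1,\dots,A_d:\mathbb{C}^{n\times n}\to\mathscr{B}(\mathcal{H})$ and $b,c\in\mathscr{B}(\mathbb{C}^n,\mathcal{H})$ such that $f(X)=(I_m\otimes b^* )L_A(X-I_m\otimes Y)^{-1}(I_m\otimes c)$ for all $X\in\mathbb{C}^{(mn\times mn)\cdot d}$, $m\in\mathbb{N}$, in some uniformly open neighbourhood of $Y$.
   Context: $\mathbb{C}^{(k\times k)\cdot d}$ denotes column $d$-tuples of complex $k\times k$ matrices, normed by $\|X\|_{\mathrm{col}}$ = operator norm of the stacked $kd\times k$ matrix. The uniform topology on $\bigsqcup_k\mathbb{C}^{(k\times k)\cdot d}$ is generated by the sets $\bigsqcup_m\{X\in\mathbb{C}^{(mk\times mk)\cdot d}:\|X-I_m\otimes Z\|_{\mathrm{col}}<r\}$ ($Z\in\mathbb{C}^{(k\times k)\cdot d}$, $r>0$). An NC function on a direct-sum-closed set $\Omega$ is a map $f$ with $f(X)\in\mathbb{C}^{k\times k}$ at level $k$, $f(X\oplus X')=f(X)\oplus f(X')$, and $f(S^{-1}XS)=S^{-1}f(X)S$ whenever $X,S^{-1}XS\in\Omega$; it is uniformly analytic if $\Omega$ is uniformly open and $f$ is locally bounded in the uniform topology. For $X\in\mathbb{C}^{(mn\times mn)\cdot d}$, viewed as $m\times m$ block matrices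 with $n\times n$ blocks, $L_A(X)=I_m\otimes I_{\mathcal{H}}-\sum_j(\mathrm{id}_m\otimes A_j)(X_j)$ where $\mathrm{id}_m\otimes A_j$ applies $A_j$ blockwise. *)

(* Defs.v *)
(* Complex numbers are R[i] (mathcomp-real-closed) over an
   arbitrary R : realType (any realType is a complete archimedean ordered
   field, so R[i] is a model of the complex numbers). *)
From HB Require Import structures.
From mathcomp Require Import all_boot all_order all_algebra.
From mathcomp Require Import reals.
From mathcomp Require Import complex mxtens.
Set Implicit Arguments. Unset Strict Implicit. Unset Printing Implicit Defensive.
Import Order.TTheory GRing.Theory Num.Theory.
Local Open Scope ring_scope.

Section NCDefs.
Variable R : realType.
Local Notation C := R[i].
Local Notation "x %:CC" := (real_complex R x) (at level 2, format "x %:CC").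

Definition cip {p} (x y : 'cV[C]_p) : C := \sum_i x i 0 * Num.conj (y i 0).

Definition vnorm2 {p} (v : 'cV[C]_p) : C := cip v v.

Variable d : nat.

Definition ncpt (k : nat) := 'I_d -> 'M[C]_k.
Definition ncset := forall k, ncpt k -> Prop.
Definition ncfun := forall k, ncpt k -> 'M[C]_k.

(* ||X||_col < r, where ||X||_col is the operator norm of the stacked
   (k d) x k matrix [X_1; ...; X_d]: since ||[X_1;..;X_d] v||^2 =
   sum_j ||X_j v||^2, this says: for some 0 <= s < r, the stacked matrix
   has operator norm <= s. *)
Definition colnorm_lt {k} (X : ncpt k) (r : R) : Prop :=
  exists s : R, [/\ 0 <= s, s < r &
    forall v : 'cV[C]_k, \sum_j vnorm2 (X j *m v) <= (s ^+ 2)%:CC * vnorm2 v].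

Definition opnorm_le {k} (M : 'M[C]_k) (c : R) : Prop :=
  forall v : 'cV[C]_k, vnorm2 (M *m v) <= (c ^+ 2)%:CC * vnorm2 v.

(* I_m (x) Z ; Kronecker product with row index (p, a) |-> p * l + a,
   i.e. block matrices with l x l blocks *)
Definition ampl {l} (m : nat) (Z : ncpt l) : ncpt (m * l) :=
  fun j => (1%:M : 'M[C]_m) *t Z j.

Definition ubasic {l} (Z : ncpt l) (r : R) (k : nat) (W : ncpt k) : Prop :=
  exists m (e : (m * l)%N = k),
    (0 < m)%N /\ colnorm_lt (fun j => W j - castmx (e, e) (ampl m Z j)) r.
Arguments ubasic {l} Z r k W.

(* openness in the topology generated by the basic uniform sets (r > 0):
   every point of U lies in a finite intersection of basic sets inside U *)
Definition uopen (U : ncset) : Prop :=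
  forall k (X : ncpt k), U k X ->
  exists (N : nat) (lv : 'I_N -> nat) (Z : forall i, ncpt (lv i)) (r : 'I_N -> R),
    [/\ forall i, 0 < r i,
        forall i, ubasic (Z i) (r i) k X &
        forall k' (W : ncpt k'), (forall i, ubasic (Z i) (r i) k' W) -> U k' W].

Definition dsum {k k'} (X : ncpt k) (X' : ncpt k') : ncpt (k + k') :=
  fun j => block_mx (X j) 0 0 (X' j).

Definition ds_closed (Om : ncset) : Prop :=
  forall k k' (X : ncpt k) (X' : ncpt k'), Om k X -> Om k' X' -> Om _ (dsum X X').

Definition is_ncfun (Om : ncset) (f : ncfun) : Prop :=
  (forall k k' (X : ncpt k) (X' : ncpt k'), Om k X -> Om k' X' ->
     f _ (dsum X X') = block_mx (f k X) 0 0 (f k' X')) /\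
  (forall k (X : ncpt k) (S : 'M[C]_k), S \in unitmx -> Om k X ->
     Om k (fun j => invmx S *m X j *m S) ->
     f k (fun j => invmx S *m X j *m S) = invmx S *m f k X *m S).

Definition loc_bdd (Om : ncset) (f : ncfun) : Prop :=
  forall k (X : ncpt k), Om k X ->
  exists V : ncset, [/\ uopen V, V k X &
    exists c : R, forall k' (W : ncpt k'), V k' W -> Om k' W -> opnorm_le (f k' W) c].

Definition unif_analytic (Om : ncset) (f : ncfun) : Prop :=
  uopen Om /\ loc_bdd Om f.

Definition ip_cauchy {H : lmodType C} (ip : H -> H -> C) (u : nat -> H) : Prop :=
  forall eps : C, 0 < eps -> exists N, forall p q, (N <= p)%N -> (N <= q)%N ->
    ip (u p - u q) (u p - u q) < eps.

Definition ip_cvg {H : lmodType C} (ip : H -> H -> C) (u : nat -> H) (l : H) : Prop :=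
  forall eps : C, 0 < eps -> exists N, forall p, (N <= p)%N ->
    ip (u p - l) (u p - l) < eps.

Record hilbert (H : lmodType C) (ip : H -> H -> C) : Prop := {
  ip_linl : forall a x y z, ip (a *: x + y) z = a * ip x z + ip y z;
  ip_csym : forall x y, ip y x = Num.conj (ip x y);
  ip_pos : forall x, 0 <= ip x x;
  ip_def : forall x, ip x x = 0 -> x = 0;
  ip_complete : forall u, ip_cauchy ip u -> exists l, ip_cvg ip u l }.

Definition bdd_lin {H1 H2 : lmodType C} (ip1 : H1 -> H1 -> C) (ip2 : H2 -> H2 -> C)
  (T : H1 -> H2) : Prop :=
  (forall a x y, T (a *: x + y) = a *: T x + T y) /\
  exists c : R, forall x, ip2 (T x) (T x) <= (c ^+ 2)%:CC * ip1 x x.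

Definition ipm {H : lmodType C} (ip : H -> H -> C) {m} (u v : {ffun 'I_m -> H}) : C :=
  \sum_p ip (u p) (v p).

Definition blk {m n} (M : 'M[C]_(m * n)) (p q : 'I_m) : 'M[C]_n :=
  \matrix_(a, b) M (mxtens_index (p, a)) (mxtens_index (q, b)).

(* L_A(X) = I_m (x) I_H - sum_j (id_m (x) A_j)(X_j), acting on H^m *)
Definition LA {H : lmodType C} {n m} (A : 'I_d -> 'M[C]_n -> H -> H)
  (X : ncpt (m * n)) (u : {ffun 'I_m -> H}) : {ffun 'I_m -> H} :=
  [ffun p => u p - \sum_j \sum_q A j (blk (X j) p q) (u q)].

Definition ampl_in {H : lmodType C} {n m} (c : 'cV[C]_n -> H) (w : 'cV[C]_(m * n))
  : {ffun 'I_m -> H} :=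
  [ffun p => c (\col_a w (mxtens_index (p, a)) 0)].

Definition adj {H : lmodType C} (ip : H -> H -> C) {n} (b : 'cV[C]_n -> H) (h : H)
  : 'cV[C]_n :=
  \col_a ip h (b (delta_mx a 0)).

Definition ampl_out {H : lmodType C} (ip : H -> H -> C) {n m} (b : 'cV[C]_n -> H)
  (u : {ffun 'I_m -> H}) : 'cV[C]_(m * n) :=
  \col_k adj ip b (u (mxtens_unindex k).1) (mxtens_unindex k).2 0.

End NCDefs.

(* Main.v *)
Require Import Defs.
From HB Require Import structures.
From mathcomp Require Import all_boot all_order all_algebra.
From mathcomp Require Import reals.
From mathcomp Require Import complex mxtens.
From mathcomp Require Import boolp classical_sets functions ring lra.
Import Order.TTheory GRing.Theory Num.Theory.
Local Open Scope ring_scope.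

(** Write [X - I (x) Y] as the sum of the [x_g (x) E_ab] over the letters
    [g = (j, a, b)], with [x_g] an [m x m] matrix.  An NC function satisfies
    [f X S = S f X'] whenever [X S = S X'], for rectangular [S].  Apply this to
    [S_g], which is [kap] times the shift by [g] on a finite prefix tree of words:
    the blocks [F_w] of the first column of [f] at such a point do not depend on
    the truncation, and they are square summable since [f] is bounded.  Let [V]
    send the basis vector of a word [w] to [kap^-|w| x^w e_p].  The defect
    [x_g V - V S_g] of the truncation tends to [0]; divided by a small [lam] and
    put in the lower left corner of [[S_g, 0], [., x_g]], it gives a point of the
    ball that [(V, lam)] intertwines with [x].  Hence
    [f X = sum_w kap^-|w| x^w (x) F_w], with an error of at most [lam] times the
    bound of [f].  This series is the transfer function of the realization on
    [l2] of the tree whose state operators are [kap^-1] times the unweighted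
    shifts, whose input is the empty word and whose output is [(F_w)_w].  Its
    resolvent is an explicit recursion along the tree. *)

Set Implicit Arguments. Unset Strict Implicit. Unset Printing Implicit Defensive.

(** * Squared moduli, Cauchy-Schwarz and Frobenius norms *)

Section Frobenius.
Variable R : realType.
Local Notation C := R[i].

Definition sqmod (z : C) : R := complex.Re z ^+ 2 + complex.Im z ^+ 2.

Lemma sqmod_ge0 z : 0 <= sqmod z.
Proof. by rewrite addr_ge0 ?sqr_ge0. Qed.

Lemma sqmod0 : sqmod 0 = 0.
Proof. by rewrite /sqmod /= !expr0n addr0. Qed.

Lemma sqmod_eq0 z : sqmod z = 0 -> z = 0.
Proof.
move/eqP; rewrite /sqmod paddr_eq0 ?sqr_ge0 // !sqrf_eq0 => /andP[/eqP a0 /eqP b0].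
by apply/eqP; rewrite eq_complex a0 b0 !eqxx.
Qed.

Lemma sqmod1 : sqmod 1 = 1.
Proof. by rewrite /sqmod /= expr0n expr1n addr0. Qed.

Lemma sqmodM z w : sqmod (z * w) = sqmod z * sqmod w.
Proof. by case: z w => [a b] [a' b']; rewrite /sqmod /=; ring. Qed.

Lemma sqmodN z : sqmod (- z) = sqmod z.
Proof. by case: z => [a b]; rewrite /sqmod /= !sqrrN. Qed.

Lemma sqmod_real (a : R) : sqmod a%:C%C = a ^+ 2.
Proof. by rewrite /sqmod /=; ring. Qed.

Lemma conjE (z : C) : Num.conj z = conjc z.
Proof. by []. Qed.

Lemma sqmod_conj z : sqmod (Num.conj z) = sqmod z.
Proof. by case: z => [a b]; rewrite /sqmod /= sqrrN. Qed.

Lemma mul_conj z : z * Num.conj z = (sqmod z)%:C%C.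
Proof.
by case: z => [a b]; rewrite conjE /sqmod /=; apply/eqP; rewrite eq_complex /=;
   apply/andP; split; apply/eqP; ring.
Qed.

(** The gap between the two sides is [t^-1 * |t z - w|^2]. The weight [t] stays free: a suitable
    choice turns this into the triangle inequality for norms. *)
Lemma sqmodD_le t z w : 0 < t ->
  sqmod (z + w) <= (1 + t) * sqmod z + (1 + t^-1) * sqmod w.
Proof.
move=> t0; case: z w => [a b] [a' b']; rewrite /sqmod /= -subr_ge0.
have tn0 : t != 0 by rewrite gt_eqF.
have -> : (1 + t) * (a ^+ 2 + b ^+ 2) + (1 + t^-1) * (a' ^+ 2 + b' ^+ 2) -
   ((a + a') ^+ 2 + (b + b') ^+ 2)
   = t^-1 * ((t * a - a') ^+ 2 + (t * b - b') ^+ 2) by field.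
by rewrite mulr_ge0 ?invr_ge0 ?(ltW t0) // addr_ge0 ?sqr_ge0.
Qed.

Lemma sqmodD_le2 z w : sqmod (z + w) <= 2 * sqmod z + 2 * sqmod w.
Proof. by have := @sqmodD_le 1 z w ltr01; rewrite invr1. Qed.

(** The induction step of Cauchy-Schwarz: the square of the cross term is at most [4 A B A' B'],
    hence at most [(A B' + A' B)^2]. *)
Lemma sqmodD_mul_le (A B A' B' : R) (s w : C) :
  0 <= A -> 0 <= B -> 0 <= A' -> 0 <= B' ->
  sqmod s <= A * B -> sqmod w <= A' * B' ->
  sqmod (s + w) <= (A + A') * (B + B').
Proof.
move=> A0 B0 A'0 B'0 sAB wAB.
set X := complex.Re s * complex.Re w + complex.Im s * complex.Im w.
have -> : sqmod (s + w) = sqmod s + 2 * X + sqmod w.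
  by rewrite /sqmod /X; case: (s) (w) => [? ?] [? ?] /=; ring.
have X2 : X ^+ 2 <= sqmod s * sqmod w.
  rewrite -subr_ge0.
  have -> : sqmod s * sqmod w - X ^+ 2 =
     (complex.Re s * complex.Im w - complex.Im s * complex.Re w) ^+ 2.
    by rewrite /sqmod /X; ring.
  exact: sqr_ge0.
have Xle : 2 * X <= A * B' + A' * B.
  set Z := A * B' + A' * B.
  have Z0 : 0 <= Z by rewrite addr_ge0 ?mulr_ge0.
  have H : (2 * X) ^+ 2 <= Z ^+ 2.
    apply: (@le_trans _ _ (4 * (A * B * (A' * B')))).
      have -> : (2 * X) ^+ 2 = 4 * X ^+ 2 by ring.
      rewrite ler_pM2l ?ltr0n //; apply: (le_trans X2).
      by apply: ler_pM => //; apply: sqmod_ge0.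
    rewrite -subr_ge0.
    have -> : Z ^+ 2 - 4 * (A * B * (A' * B')) = (A * B' - A' * B) ^+ 2.
      by rewrite /Z; ring.
    exact: sqr_ge0.
  apply: (le_trans (ler_norm _)).
  by rewrite -(ler_pXn2r (ltn0Sn 1)) ?nnegrE ?normr_ge0 // real_normK ?num_real.
have -> : (A + A') * (B + B') = A * B + (A * B' + A' * B) + A' * B' by ring.
by apply: lerD => //; apply: lerD.
Qed.

(** With majorants [A], [B] in place of squared moduli, one statement serves products of scalars as
    well as inner products of vectors. *)
Lemma sqmod_sum_mul_le (I : Type) (r : seq I) (z : I -> C) (A B : I -> R) :
  (forall i, 0 <= A i) -> (forall i, 0 <= B i) ->
  (forall i, sqmod (z i) <= A i * B i) ->
  sqmod (\sum_(i <- r) z i) <= (\sum_(i <- r) A i) * (\sum_(i <- r) B i).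
Proof.
move=> A0 B0 H; elim: r => [|i r IH]; first by rewrite !big_nil sqmod0 mulr0.
by rewrite !big_cons sqmodD_mul_le ?sumr_ge0.
Qed.

Lemma sqmod_dot_le (I : Type) (r : seq I) (a b : I -> C) :
  sqmod (\sum_(i <- r) a i * b i) <=
  (\sum_(i <- r) sqmod (a i)) * (\sum_(i <- r) sqmod (b i)).
Proof.
by apply: sqmod_sum_mul_le => i; rewrite ?sqmod_ge0 ?sqmodM.
Qed.

Definition frob2 {p q} (A : 'M[C]_(p, q)) : R := \sum_i \sum_j sqmod (A i j).

Lemma frob2_ge0 p q (A : 'M[C]_(p, q)) : 0 <= frob2 A.
Proof. by apply: sumr_ge0 => i _; apply: sumr_ge0 => j _; apply: sqmod_ge0. Qed.

Lemma frob20 p q : frob2 (0 : 'M[C]_(p, q)) = 0.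
Proof. by rewrite /frob2 big1 // => i _; rewrite big1 // => j _; rewrite mxE sqmod0. Qed.

Lemma frob2E p (v : 'cV[C]_p) : frob2 v = \sum_i sqmod (v i 0).
Proof. by apply: eq_bigr => i _; rewrite big_ord1. Qed.

Lemma frob2Z p q a (A : 'M[C]_(p, q)) : frob2 (a *: A) = sqmod a * frob2 A.
Proof.
rewrite /frob2 mulr_sumr; apply: eq_bigr => i _; rewrite mulr_sumr.
by apply: eq_bigr => j _; rewrite mxE sqmodM.
Qed.

Lemma frob2_tr p q (A : 'M[C]_(p, q)) : frob2 A^T = frob2 A.
Proof.
rewrite /frob2 exchange_big; apply: eq_bigr => i _; apply: eq_bigr => j _.
by rewrite mxE.
Qed.

Lemma frob2D_le t p q (A B : 'M[C]_(p, q)) : 0 < t ->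
  frob2 (A + B) <= (1 + t) * frob2 A + (1 + t^-1) * frob2 B.
Proof.
move=> t0; rewrite /frob2 !mulr_sumr -big_split; apply: ler_sum => i _ /=.
rewrite !mulr_sumr -big_split; apply: ler_sum => j _ /=.
by rewrite mxE; apply: sqmodD_le.
Qed.

Lemma frob2D_le2 p q (A B : 'M[C]_(p, q)) :
  frob2 (A + B) <= 2 * frob2 A + 2 * frob2 B.
Proof. by have := @frob2D_le 1 _ _ A B ltr01; rewrite invr1. Qed.

Lemma sqmod_sum_le (I : finType) (z : I -> C) :
  sqmod (\sum_i z i) <= #|I|%:R * \sum_i sqmod (z i).
Proof.
have := @sqmod_dot_le _ (index_enum I) (fun=> 1) z.
under eq_bigr do rewrite mul1r.
move=> /le_trans; apply; rewrite (eq_bigr (fun=> 1)) => [|? _]; last exact: sqmod1.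
by rewrite sumr_const.
Qed.

Lemma frob2_cols p q (A : 'M[C]_(p, q)) : frob2 A = \sum_j frob2 (col j A).
Proof.
rewrite /frob2 exchange_big; apply: eq_bigr => j _; apply: eq_bigr => i _.
by rewrite big_ord1 mxE.
Qed.

Lemma frob2_mul p q r (A : 'M[C]_(p, q)) (B : 'M[C]_(q, r)) :
  frob2 (A *m B) <= frob2 A * frob2 B.
Proof.
rewrite {1 2}/frob2 mulr_suml; apply: ler_sum => i _.
rewrite [frob2 B]exchange_big mulr_sumr; apply: ler_sum => j _.
by rewrite mxE; apply: sqmod_dot_le.
Qed.

Lemma sqmod_le_frob2 p q (A : 'M[C]_(p, q)) i j : sqmod (A i j) <= frob2 A.
Proof.
rewrite /frob2 (bigD1 i) //= (bigD1 j) //= -addrA lerDl addr_ge0 //.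
  by apply: sumr_ge0 => *; apply: sqmod_ge0.
by apply: sumr_ge0 => *; apply: sumr_ge0 => *; apply: sqmod_ge0.
Qed.

Lemma frob2_opbound p q (M : 'M[C]_(p, q)) (c : R) :
  (forall v : 'cV[C]_q, frob2 (M *m v) <= c * frob2 v) ->
  forall r (A : 'M[C]_(q, r)), frob2 (M *m A) <= c * frob2 A.
Proof.
move=> H r A; rewrite !frob2_cols mulr_sumr; apply: ler_sum => j _.
by rewrite colE -mulmxA -colE.
Qed.

Lemma frob2_col_mx p1 p2 q (A : 'M[C]_(p1, q)) (B : 'M[C]_(p2, q)) :
  frob2 (col_mx A B) = frob2 A + frob2 B.
Proof.
rewrite /frob2 big_split_ord; congr (_ + _); apply: eq_bigr => i _; apply: eq_bigr => j _.
  by rewrite col_mxEu.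
by rewrite col_mxEd.
Qed.

Lemma frob2_delta p q i j : frob2 (delta_mx i j : 'M[C]_(p, q)) = 1.
Proof.
rewrite /frob2 (bigD1 i) //= (bigD1 j) //= mxE !eqxx sqmod1.
rewrite !big1 ?addr0 // => [k /negPf ki|k /negPf kj]; last by rewrite mxE kj andbF sqmod0.
by rewrite big1 // => l _; rewrite mxE ki sqmod0.
Qed.

Lemma frob2_eq0 p q (A : 'M[C]_(p, q)) : frob2 A = 0 -> A = 0.
Proof.
move=> A0; apply/matrixP => i j; rewrite mxE.
have := sqmod_le_frob2 A i j; rewrite A0 => Aij.
by apply: sqmod_eq0; apply/eqP; rewrite eq_le Aij sqmod_ge0.
Qed.

Lemma cip_le p (x y : 'cV[C]_p) : sqmod (cip x y) <= frob2 x * frob2 y.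
Proof.
rewrite !frob2E; apply: sqmod_sum_mul_le => i; rewrite ?sqmod_ge0 //.
by rewrite sqmodM sqmod_conj.
Qed.

Lemma vnorm2E p (v : 'cV[C]_p) : vnorm2 v = (frob2 v)%:C%C.
Proof.
rewrite /vnorm2 /cip frob2E rmorph_sum; apply: eq_bigr => i _; exact: mul_conj.
Qed.

Lemma colnorm_ltP d k (X : ncpt R d k) (r : R) :
  colnorm_lt X r <-> exists s : R, [/\ 0 <= s, s < r &
    forall v : 'cV[C]_k, \sum_j frob2 (X j *m v) <= s ^+ 2 * frob2 v].
Proof.
split=> -[s [s0 sr H]]; exists s; split=> // v; have := H v.
  rewrite (eq_bigr (fun j => (frob2 (X j *m v))%:C%C)) => [|j _]; last exact: vnorm2E.
  by rewrite vnorm2E -rmorph_sum -rmorphM lecR.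
rewrite [X in _ -> X <= _](eq_bigr (fun j => (frob2 (X j *m v))%:C%C)) => [|j _]; last exact: vnorm2E.
by rewrite vnorm2E -rmorph_sum -rmorphM lecR.
Qed.

Lemma opnorm_leP k (M : 'M[C]_k) (c : R) :
  opnorm_le M c <-> forall v : 'cV[C]_k, frob2 (M *m v) <= c ^+ 2 * frob2 v.
Proof. by split=> H v; have := H v; rewrite !vnorm2E -rmorphM lecR. Qed.

End Frobenius.

(** * Uniform balls, intertwining by NC functions, and coordinates around [Y] *)

Section UniformBalls.
Variable R : realType.
Local Notation C := R[i].

Lemma sum_mxtens (V : nmodType) m n (F : 'I_(m * n) -> V) :
  \sum_k F k = \sum_p \sum_a F (mxtens_index (p, a)).
Proof.
rewrite (reindex (@mxtens_index m n)) /=; last first.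
  by exists (@mxtens_unindex m n) => k _; rewrite (mxtens_indexK, mxtens_unindexK).
by rewrite pair_big /=; apply: eq_bigr => -[p a] _.
Qed.

Definition rowblk {m n q} (p : 'I_m) (v : 'M[C]_(m * n, q)) : 'M[C]_(n, q) :=
  \matrix_(a, i) v (mxtens_index (p, a)) i.

Lemma frob2_rowblk m n q (v : 'M[C]_(m * n, q)) :
  frob2 v = \sum_p frob2 (rowblk p v).
Proof.
rewrite /frob2 sum_mxtens; apply: eq_bigr => p _; apply: eq_bigr => a _.
by apply: eq_bigr => i _; rewrite mxE.
Qed.

Lemma rowblk_ampl m n q (Z : 'M[C]_n) (v : 'M[C]_(m * n, q)) p :
  rowblk p (((1%:M : 'M[C]_m) *t Z) *m v) = Z *m rowblk p v.
Proof.
apply/matrixP => a i; rewrite !mxE sum_mxtens (bigD1 p) //= [X in _ + X]big1 ?addr0.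
  by apply: eq_bigr => b _; rewrite tensmxE !mxE eqxx mul1r.
move=> p' /negPf pp; rewrite big1 // => b _.
by rewrite tensmxE mxE eq_sym pp !mul0r.
Qed.

Lemma sum_frob2_ampl_le (I : finType) m n (D : I -> 'M[C]_n) (c : R) :
  (forall v : 'cV[C]_n, \sum_j frob2 (D j *m v) <= c * frob2 v) ->
  forall v : 'cV[C]_(m * n),
    \sum_j frob2 (((1%:M : 'M[C]_m) *t D j) *m v) <= c * frob2 v.
Proof.
move=> H v; under eq_bigr do rewrite frob2_rowblk.
rewrite exchange_big frob2_rowblk mulr_sumr; apply: ler_sum => p _ /=.
by under eq_bigr do rewrite rowblk_ampl; apply: H.
Qed.

Lemma ampl_ampl m k l n (e : (k * l)%N = n) (e' : (m * k * l)%N = (m * n)%N)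
  (Z : 'M[C]_l) :
  castmx (e', e') ((1%:M : 'M[C]_(m * k)) *t Z) =
  (1%:M : 'M[C]_m) *t castmx (e, e) ((1%:M : 'M[C]_k) *t Z).
Proof.
subst n; rewrite castmx_id; apply/matrixP => i j; rewrite castmxE /=.
case: (mxtens_indexP i) => p ia; case: (mxtens_indexP ia) => t a.
case: (mxtens_indexP j) => q jb; case: (mxtens_indexP jb) => u b.
have E (p0 : 'I_m) (t0 : 'I_k) (a0 : 'I_l) :
    cast_ord (esym e') (mxtens_index (p0, mxtens_index (t0, a0))) =
    mxtens_index (mxtens_index (p0, t0), a0).
  by apply: val_inj => /=; rewrite mulnDl addnA mulnA.
rewrite !E !tensmxE !mxE (can_eq (@mxtens_indexK _ _)) xpair_eqE.
by rewrite mulrA -natrM mulnb.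
Qed.

Variable d : nat.

Lemma colnorm_ltD k (X Z : ncpt R d k) r s :
  colnorm_lt X r -> colnorm_lt Z s -> colnorm_lt (fun j => X j + Z j) (r + s).
Proof.
move=> /colnorm_ltP[x [x0 xr HX]] /colnorm_ltP[z [z0 zs HZ]].
apply/colnorm_ltP.
(* The midpoints are positive, so division by them is allowed, and they stay strictly below [r] and
   [s]. *)
pose x' := (x + r) / 2; pose z' := (z + s) / 2.
have x'0 : 0 < x' by rewrite /x'; lra.
have z'0 : 0 < z' by rewrite /z'; lra.
have xx' : x <= x' by rewrite /x'; lra.
have zz' : z <= z' by rewrite /z'; lra.
exists (x' + z'); split; [lra | by rewrite /x' /z'; lra | move=> v].
(* With the weight [z' / x'] the two squared bounds recombine to exactly [(x' + z') ^+ 2]. *)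
have t0 : 0 < z' / x' by rewrite divr_gt0.
apply: (@le_trans _ _ (\sum_j ((1 + z' / x') * frob2 (X j *m v) +
   (1 + (z' / x')^-1) * frob2 (Z j *m v)))).
  by apply: ler_sum => j _; rewrite mulmxDl; apply: frob2D_le.
rewrite big_split /= -!mulr_sumr.
have v0 := frob2_ge0 v.
have -> : (x' + z') ^+ 2 * frob2 v =
  (1 + z' / x') * (x' ^+ 2 * frob2 v) + (1 + (z' / x')^-1) * (z' ^+ 2 * frob2 v).
  by field; rewrite !gt_eqF.
apply: lerD; rewrite ler_pM2l ?addr_gt0 ?invr_gt0 //.
  by apply: (le_trans (HX v)); rewrite ler_wpM2r // lerXn2r ?nnegrE // ltW.
by apply: (le_trans (HZ v)); rewrite ler_wpM2r // lerXn2r ?nnegrE // ltW.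
Qed.

Lemma colnorm_ltW k (X : ncpt R d k) r s :
  r <= s -> colnorm_lt X r -> colnorm_lt X s.
Proof. by move=> rs [x [x0 xr H]]; exists x; split=> //; apply: lt_le_trans rs. Qed.

Lemma colnorm_lt_ampl m n (X : ncpt R d n) r :
  colnorm_lt X r -> colnorm_lt (ampl m X) r.
Proof.
move=> /colnorm_ltP[s [s0 sr H]]; apply/colnorm_ltP; exists s; split=> //.
exact: sum_frob2_ampl_le.
Qed.

(** Amplifying [Z] by [m'] to the size of [Y] and then by [m] to the size of [W] is one
    amplification by [m * m']. So [W - I (x) Z] splits into [W - I (x) Y] and an amplification of
    [Y - I (x) Z], whose column bound is unchanged. The new radius is half of the slack at [Y]. *)
Lemma ubasic_ampl_trans n l (Y : ncpt R d n) (Z : ncpt R d l) (r : R) :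
  ubasic Z r Y -> exists2 s : R, 0 < s & forall k (W : ncpt R d k),
    ubasic Y s W -> ubasic Z r W.
Proof.
move=> [m' [e [m'0 YZ]]].
have [t [t0 tr Ht]] := YZ; exists ((r - t) / 2); first lra.
move=> k W [m [e2 [m0 WY]]]; subst k.
have e' : (m * m' * l)%N = (m * n)%N by rewrite -mulnA e.
exists (m * m')%N, e'; split; first by rewrite muln_gt0 m0.
have YZ' : colnorm_lt (fun j => Y j - castmx (e, e) (ampl m' Z j)) ((r + t) / 2).
  by exists t; split; [exact: t0 | lra | exact: Ht].
have H := colnorm_ltD WY (colnorm_lt_ampl m YZ').
have E : (r - t) / 2 + (r + t) / 2 = r by lra.
rewrite E in H; move: H.
set F := (X in colnorm_lt X _ -> _); set G := (X in _ -> colnorm_lt X _).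
suff -> : F = G by [].
apply: funext => j; rewrite /F /G castmx_id /ampl (ampl_ampl e).
have -> : (1%:M : 'M[C]_m) *t (Y j - castmx (e, e) ((1%:M : 'M[C]_m') *t Z j)) =
   (1%:M : 'M[C]_m) *t Y j - (1%:M : 'M[C]_m) *t castmx (e, e) ((1%:M : 'M[C]_m') *t Z j).
  by apply/matrixP => a b; rewrite !mxE mulrBr.
by rewrite addrA subrK.
Qed.

Lemma uopen_ball (U : ncset R d) n (Y : ncpt R d n) : uopen U -> U n Y ->
  exists2 r : R, 0 < r & forall k (W : ncpt R d k), ubasic Y r W -> U k W.
Proof.
move=> Uo UY; have [N [lv [Z [r [r0 YZ ZU]]]]] := Uo _ _ UY.
have /fin_all_exists2[s s0 Hs] := fun i => ubasic_ampl_trans (YZ i).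
(* The initial [1] yields a positive radius even for an empty intersection. *)
exists (\big[Num.min/1]_i s i).
  by apply: lt_bigmin => [|i _]; [exact: ltr01 | exact: s0].
move=> k W [m [e [m0 H]]]; apply: ZU => i; apply: Hs.
by exists m, e; split=> //; apply: colnorm_ltW H; apply: bigmin_le.
Qed.

Lemma ubasic_uopen n (Y : ncpt R d n) (r : R) : 0 < r -> uopen (ubasic Y r).
Proof.
move=> r0 k X YX; exists 1%N, (fun=> n), (fun=> Y), (fun=> r).
by split=> // k' W /(_ ord0).
Qed.

Lemma ubasic_id n (Y : ncpt R d n) (r : R) : 0 < r -> ubasic Y r Y.
Proof.
move=> r0; exists 1%N, (mul1n n); split=> //; apply/colnorm_ltP.
exists 0; split=> // v; rewrite expr0n mul0r big1 // => j _.
suff -> : Y j - castmx (mul1n n, mul1n n) (ampl 1 Y j) = 0 by rewrite mul0mx frob20.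
apply/eqP; rewrite subr_eq0; apply/eqP/matrixP => a b; rewrite castmxE /=.
have E (c : 'I_n) : cast_ord (esym (mul1n n)) c = mxtens_index (ord0 : 'I_1, c).
  by apply: val_inj => /=; rewrite mul0n.
by rewrite !E tensmxE mxE eqxx mul1r.
Qed.

(** The unipotent matrix [[[1, S], [0, 1]]] commutes with the direct sum of [X] and [X'] exactly
    because [X S = S X']. By similarity invariance it then commutes with the direct sum of the
    values, and the upper right blocks give the claim. *)
Lemma nc_intertwine (Om : ncset R d) (f : ncfun R d) :
  ds_closed Om -> is_ncfun Om f ->
  forall k k' (X : ncpt R d k) (X' : ncpt R d k') (S : 'M[C]_(k, k')),
  Om k X -> Om k' X' -> (forall j, X j *m S = S *m X' j) ->
  f k X *m S = S *m f k' X'.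
Proof.
move=> dsO [fds fsim] k k' X X' S OX OX' XS.
pose P : 'M[C]_(k + k') := block_mx 1%:M S 0 1%:M.
have Pu : P \in unitmx by rewrite unitmxE det_ublock !det1 mulr1 unitr1.
have PD : (fun j => invmx P *m dsum X X' j *m P) = dsum X X'.
  apply: funext => j; rewrite -mulmxA.
  suff -> : dsum X X' j *m P = P *m dsum X X' j by rewrite mulKmx.
  rewrite /dsum /P !mulmx_block !(mul0mx, mulmx0, mul1mx, mulmx1, addr0, add0r).
  by rewrite XS.
have OD := dsO _ _ _ _ OX OX'.
have := fsim _ _ P Pu OD; rewrite PD => /(_ OD).
rewrite (fds _ _ _ _ OX OX') -mulmxA => /(congr1 (mulmx P)).
rewrite mulKVmx // /P !mulmx_block !(mul0mx, mulmx0, mul1mx, mulmx1, addr0, add0r).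
by move=> /eq_block_mx[_ -> _ _].
Qed.

Variables (n : nat) (Y : ncpt R d n).

Definition coeffs (m : nat) := 'I_d -> 'I_n -> 'I_n -> 'M[C]_m.

Definition emb {m} (x : coeffs m) : ncpt R d (m * n) := fun j =>
  (1%:M : 'M[C]_m) *t Y j + \sum_a \sum_b x j a b *t (delta_mx a b : 'M[C]_n).

Definition coords {m} (X : ncpt R d (m * n)) : coeffs m := fun j a b =>
  \matrix_(p, q) (X j - ampl m Y j) (mxtens_index (p, a)) (mxtens_index (q, b)).

Lemma embB m (x : coeffs m) j p a q b :
  (emb x j - ampl m Y j) (mxtens_index (p, a)) (mxtens_index (q, b)) = x j a b p q.
Proof.
rewrite /emb /ampl addrC addKr summxE (bigD1 a) //= summxE (bigD1 b) //=.
rewrite tensmxE mxE !eqxx mulr1 !big1 ?addr0 // => [a' /negPf aa|b' /negPf bb].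
  by rewrite summxE big1 // => b' _; rewrite tensmxE mxE eq_sym aa mulr0.
by rewrite tensmxE mxE [b == _]eq_sym bb andbF mulr0.
Qed.

Lemma embK m (X : ncpt R d (m * n)) : emb (coords X) = X.
Proof.
apply: funext => j; apply: (@addIr _ (- ampl m Y j)).
apply/matrixP => i i'; case: (mxtens_indexP i) => p a; case: (mxtens_indexP i') => q b.
by rewrite embB mxE.
Qed.

Lemma emb_intertwine m m' (x : coeffs m) (x' : coeffs m') (T : 'M[C]_(m, m')) :
  (forall j a b, x j a b *m T = T *m x' j a b) ->
  forall j, emb x j *m (T *t (1%:M : 'M[C]_n)) = (T *t 1%:M) *m emb x' j.
Proof.
move=> H j; rewrite /emb mulmxDl mulmxDr !tensmx_mul !(mul1mx, mulmx1).
congr (_ + _); rewrite mulmx_suml mulmx_sumr; apply: eq_bigr => a _.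
rewrite mulmx_suml mulmx_sumr; apply: eq_bigr => b _.
by rewrite !tensmx_mul H mul1mx mulmx1.
Qed.

(** Compression: [v] is placed in slot [b] of every block and the image is read in slot [a] only,
    which cannot increase the norm. *)
Lemma coords_bound m (X : ncpt R d (m * n)) (s : R) :
  (forall v : 'cV[C]_(m * n),
     \sum_j frob2 ((X j - ampl m Y j) *m v) <= s * frob2 v) ->
  forall j a b (v : 'cV[C]_m), frob2 (coords X j a b *m v) <= s * frob2 v.
Proof.
move=> H j a b v.
pose w : 'cV[C]_(m * n) := \col_k
  (((mxtens_unindex k).2 == b)%:R * v (mxtens_unindex k).1 0).
have wE p i : w (mxtens_index (p, i)) 0 = (i == b)%:R * v p 0.
  by rewrite mxE mxtens_indexK.
have <- : frob2 w = frob2 v.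
  rewrite !frob2E sum_mxtens; apply: eq_bigr => p _.
  rewrite (bigD1 b) //= wE eqxx mul1r big1 ?addr0 // => i /negPf ib.
  by rewrite wE ib mul0r sqmod0.
apply: le_trans (H w); rewrite (bigD1 j) //=.
apply: (@le_trans _ _ (frob2 ((X j - ampl m Y j) *m w))); last first.
  by rewrite lerDl; apply: sumr_ge0 => *; apply: frob2_ge0.
rewrite !frob2E sum_mxtens; apply: ler_sum => p _ /=.
rewrite (bigD1 a) //= -[leLHS]addr0 lerD //; last first.
  by apply: sumr_ge0 => *; apply: sqmod_ge0.
rewrite le_eqVlt; apply/orP; left; apply/eqP; congr sqmod; rewrite !mxE sum_mxtens; apply: eq_bigr => q _.
rewrite (bigD1 b) //= wE eqxx mul1r big1 ?addr0 => [|i /negPf ib]; first by rewrite mxE.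
by rewrite wE ib mul0r mulr0.
Qed.

(** Cauchy-Schwarz over [n] column slots, then summation over [n] row slots and [d] coordinates,
    gives the factor [d n^2 del^2], at most [((d n^2 + 1) del)^2 = (r / 2)^2]. The added [1] keeps
    the factor nonzero when [d = 0]. *)
Lemma emb_ubasic m (x : coeffs m) (r del : R) : (0 < m)%N -> 0 < r ->
  ((d * n * n).+1)%:R * del = r / 2 ->
  (forall j a b (v : 'cV[C]_m), frob2 (x j a b *m v) <= del ^+ 2 * frob2 v) ->
  ubasic Y r (emb x).
Proof.
move=> m0 r0 delE H; exists m, erefl; split=> //; apply/colnorm_ltP.
exists (r / 2); split; [lra | lra | move=> v].
pose colblk (b : 'I_n) : 'cV[C]_m := \col_q v (mxtens_index (q, b)) 0.
have vE : frob2 v = \sum_b frob2 (colblk b).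
  rewrite frob2E sum_mxtens exchange_big; apply: eq_bigr => b _.
  by rewrite frob2E; apply: eq_bigr => q _; rewrite mxE.
have S1 j : frob2 ((emb x j - castmx (erefl (m * n)%N, erefl (m * n)%N) (ampl m Y j)) *m v)
    <= (n * n)%:R * del ^+ 2 * frob2 v.
  rewrite castmx_id frob2E sum_mxtens exchange_big /=.
  have -> : (n * n)%:R * del ^+ 2 * frob2 v = \sum_(a < n) (n%:R * (del ^+ 2 * frob2 v)).
    by rewrite sumr_const card_ord -[RHS]mulr_natl natrM !mulrA.
  apply: ler_sum => a _.
  rewrite vE !mulr_sumr.
  apply: (@le_trans _ _ (\sum_b n%:R * frob2 (x j a b *m colblk b))); last first.
    by apply: ler_sum => b _; rewrite ler_wpM2l ?ler0n.
  rewrite -mulr_sumr.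
  under [X in _ <= _ * X]eq_bigr do rewrite frob2E.
  rewrite exchange_big /= mulr_sumr; apply: ler_sum => p _.
  rewrite mxE sum_mxtens exchange_big /=.
  have := sqmod_sum_le (fun b => (x j a b *m colblk b) p 0); rewrite card_ord.
  congr (sqmod _ <= _); apply: eq_bigr => b _; rewrite mxE; apply: eq_bigr => q _.
  by rewrite embB !mxE.
apply: (le_trans (ler_sum _ (fun j _ => S1 j))).
rewrite sumr_const card_ord -[leLHS]mulr_natl !mulrA -natrM mulnA -delE.
rewrite -[_ * del * del]mulrA -expr2.
rewrite ler_wpM2r ?frob2_ge0 // exprMn ler_wpM2r ?sqr_ge0 // -natrX ler_nat.
by apply: (leq_trans (leqnSn _)); exact: (@leq_pexp2l (d * n * n).+1 1 2).
Qed.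

End UniformBalls.

(** * Nonnegative series and sums along a tree *)

Section RealSums.
Variable R : realType.
Implicit Types a b : nat -> R.

Lemma ler_psum_nat a M M' : (forall k, 0 <= a k) -> (M <= M')%N ->
  \sum_(0 <= k < M) a k <= \sum_(0 <= k < M') a k.
Proof.
move=> a0 MM; rewrite (big_cat_nat (leq0n M) MM) //= lerDl.
by apply: sumr_ge0 => *; apply: a0.
Qed.

(** Some partial sum comes within [e] of the supremum, so no later segment can add more than [e]. *)
Lemma psum_tail a B : (forall k, 0 <= a k) ->
  (forall M, \sum_(0 <= k < M) a k <= B) ->
  forall e, 0 < e -> exists M0, forall M M', (M0 <= M)%N ->
    \sum_(M <= k < M') a k <= e.
Proof.
move=> a0 aB e e0; pose E : set R := fun y => exists M, y = \sum_(0 <= k < M) a k.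
have hE : has_sup E.
  split; first by exists (\sum_(0 <= k < 0) a k), 0%N.
  by exists B => _ [M ->].
have [_ [M0 ->] HM0] := sup_adherent e0 hE.
exists M0 => M M' M0M; have [MM'|M'M] := leqP M M'; last first.
  by rewrite big_geq ?ltW // ltnW.
have H1 : \sum_(0 <= k < M') a k <= sup E.
  by apply: ub_le_sup; [case: hE | exists M'].
have H2 : \sum_(0 <= k < M0) a k <= \sum_(0 <= k < M) a k by exact: ler_psum_nat.
rewrite (big_cat_nat (leq0n M) MM') //= in H1; lra.
Qed.

(** Extending the range to [M * N] makes all fibres of [k %/ N] complete, each with [N] elements. *)
Lemma sum_divn_le a M N : (0 < N)%N -> (forall k, 0 <= a k) ->
  \sum_(0 <= k < M) a (k %/ N)%N <= N%:R * \sum_(0 <= k < M) a k.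
Proof.
move=> N0 a0; apply: (@le_trans _ _ (\sum_(0 <= k < M * N) a (k %/ N)%N)).
  by apply: ler_psum_nat => [k|]; [exact: a0 | exact: leq_pmulr].
rewrite big_mkord sum_mxtens big_mkord mulr_sumr; apply: ler_sum => p _ /=.
rewrite (eq_bigr (fun=> a p)) => [|i _]; last first.
  by rewrite divnMDl // divn_small // addn0.
by rewrite sumr_const card_ord mulr_natl.
Qed.

(** Absorption: [k %/ N] is the parent of node [k.+1] and each node has [N] children, so the total
    [S] of [a] satisfies [S <= 2 * sum b + N q S], and [N q <= 1 / 2] moves the last term to the
    left. *)
Lemma sum_tree_le a b q N : (0 < N)%N -> (forall k, 0 <= a k) -> 0 <= q ->
  (forall k, 0 <= b k) ->
  N%:R * q <= 1 / 2 -> a 0%N <= 2 * b 0%N ->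
  (forall k, a k.+1 <= 2 * b k.+1 + q * a (k %/ N)%N) ->
  forall M, \sum_(0 <= k < M) a k <= 4 * \sum_(0 <= k < M) b k.
Proof.
move=> N0 a0 q0 b0 Nq H0 HS M.
have H : \sum_(0 <= k < M) a k <=
    2 * (\sum_(0 <= k < M) b k) + q * \sum_(0 <= k < M) a (k %/ N)%N.
  case: M => [|M]; first by rewrite !big_geq // !mulr0 addr0.
  rewrite big_nat_recl // [\sum_(0 <= k < M.+1) b k]big_nat_recl // mulrDr -addrA.
  apply: lerD; first exact: H0.
  apply: (@le_trans _ _ (\sum_(0 <= k < M) (2 * b k.+1 + q * a (k %/ N)%N))).
    by apply: ler_sum => k _; apply: HS.
  rewrite big_split /= -!mulr_sumr lerD2l ler_wpM2l //.
  by apply: (@ler_psum_nat (fun k => a (k %/ N)%N)).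
have A0 : 0 <= \sum_(0 <= k < M) a k by apply: sumr_ge0 => *; apply: a0.
have H1 := sum_divn_le M N0 a0.
have H2 : q * \sum_(0 <= k < M) a (k %/ N)%N <= 1 / 2 * \sum_(0 <= k < M) a k.
  apply: (@le_trans _ _ (q * (N%:R * \sum_(0 <= k < M) a k))); first by rewrite ler_wpM2l.
  by rewrite mulrA [q * _]mulrC ler_wpM2r.
lra.
Qed.

Lemma sum_incr_le a (c : nat -> nat) M : (forall k, 0 <= a k) ->
  (forall k, (c k < c k.+1)%N) ->
  \sum_(0 <= l < M) a (c l) <= \sum_(0 <= k < c M) a k.
Proof.
move=> a0 cS; elim: M => [|M IH].
  by rewrite big_geq //; apply: sumr_ge0 => *; apply: a0.
rewrite big_nat_recr //=; apply: (@le_trans _ _ (\sum_(0 <= k < (c M).+1) a k)).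
  by rewrite big_nat_recr //= lerD2r.
exact: ler_psum_nat.
Qed.

End RealSums.

(** * Words as tree nodes, recursion along the tree, truncated shifts *)

Section Tree.
Variable R : realType.
Local Notation C := R[i].
Variables d n : nat.

(* The N-ary tree on nat: the nodes are the words in the letters [0 .. N-1], and
   prepending the letter [i] to the word [k] gives the word [N * k + i + 1].
   The letter [N-1] is not the rank of a triple; it ensures [0 < N]. *)
Definition nletters := locked #|{: 'I_d * 'I_n * 'I_n}|.+1.
Definition rk (j : 'I_d) (a b : 'I_n) : nat := enum_rank (j, a, b).
Definition child (k i : nat) : nat := (k * nletters + i).+1.

Lemma nletters_gt0 : (0 < nletters)%N.
Proof. by rewrite /nletters -lock. Qed.

Lemma rk_lt j a b : (rk j a b < nletters)%N.
Proof. by rewrite /nletters -lock ltnW // ltnS ltn_ord. Qed.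

Lemma rk_inj j a b j' a' b' : rk j a b = rk j' a' b' -> [/\ j = j', a = a' & b = b'].
Proof. by move=> /ord_inj /enum_rank_inj[-> -> ->]. Qed.

Lemma ltn_child k i : (k < child k i)%N.
Proof. by rewrite ltnS (leq_trans _ (leq_addr _ _)) // leq_pmulr // nletters_gt0. Qed.

Lemma child_incr i k : (child k i < child k.+1 i)%N.
Proof. by rewrite /child ltnS ltn_add2r ltn_pmul2r // nletters_gt0. Qed.

Lemma child_inj i : injective (child^~ i).
Proof.
by move=> k l [] /eqP; rewrite eqn_add2r eqn_pmul2r ?nletters_gt0 // => /eqP ->.
Qed.

(** Letters become plain numbers; a number that is not the rank of a triple acts as [0]. *)
Definition letx {m} (x : coeffs R d n m) (i : nat) : 'M[C]_m :=
  \sum_j \sum_a \sum_b (rk j a b == i)%:R *: x j a b.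

Lemma letx_rk m (x : coeffs R d n m) j a b : letx x (rk j a b) = x j a b.
Proof.
rewrite /letx (bigD1 j) //= (bigD1 a) //= (bigD1 b) //= eqxx scale1r.
rewrite !big1 ?addr0 // => [j' /eqP H|a' /eqP H|b' /eqP H].
- rewrite big1 // => a' _; rewrite big1 // => b' _.
  by case: eqP => [/rk_inj[]|] //; rewrite scale0r.
- by rewrite big1 // => b' _; case: eqP => [/rk_inj[]|] //; rewrite scale0r.
- by case: eqP => [/rk_inj[]|] //; rewrite scale0r.
Qed.

Lemma letx_cases m (x : coeffs R d n m) i :
  (exists j a b, i = rk j a b) \/ letx x i = 0.
Proof.
have [H|H] := pselect (exists j a b, i = rk j a b); [by left | right].
rewrite /letx big1 // => j _; rewrite big1 // => a _; rewrite big1 // => b _.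
case: eqP => [E|]; last by rewrite scale0r.
by case: H; exists j, a, b.
Qed.

Definition opbounded {m} (x : coeffs R d n m) (s : R) :=
  forall j a b (v : 'cV[C]_m), frob2 (x j a b *m v) <= s * frob2 v.

Lemma letx_bound m (x : coeffs R d n m) s i q (A : 'M[C]_(m, q)) : 0 <= s ->
  opbounded x s -> frob2 (letx x i *m A) <= s * frob2 A.
Proof.
move=> s0 xs; have [[j [a [b ->]]]|->] := letx_cases x i.
  by rewrite letx_rk; apply: frob2_opbound => v; apply: xs.
by rewrite mul0mx frob20 mulr_ge0 ?frob2_ge0.
Qed.

Section Recursion.
Variables (kap : R) (m q : nat) (x : coeffs R d n m) (W : nat -> 'M[C]_(m, q)).

(** Node [k'.+1] has first letter [k' %% nletters] and parent [k' %/ nletters]. This is the state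
    operator of the realization read at one node; the root has no parent and receives [0]. *)
Definition step (k : nat) (Z : nat -> 'M[C]_(m, q)) : 'M[C]_(m, q) :=
  if k is k'.+1 then (kap^-1)%:C%C *: (letx x (k' %% nletters)%N *m Z (k' %/ nletters)%N)
  else 0.

(** The argument [t] is fuel: the value at [k] involves only ancestors of [k], so every [t > k]
    gives the same result. *)
Fixpoint solf (t k : nat) : 'M[C]_(m, q) :=
  if t is t'.+1 then W k + step k (solf t') else 0.

Definition sol : nat -> 'M[C]_(m, q) := locked (fun k => solf k.+1 k).

Lemma solfS t k : solf t.+1 k = W k + step k (solf t).
Proof. by []. Qed.

Lemma divn_nletters_lt k : (k %/ nletters < k.+1)%N.
Proof. by rewrite ltnS leq_div. Qed.

Lemma solfE t k : (k < t)%N -> solf t k = sol k.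
Proof.
rewrite /sol -lock; elim/ltn_ind: k t => k IH [//|t] kt; rewrite !solfS; congr (_ + _).
case: k IH kt => [//|k] IH kt; rewrite /step.
have kk := divn_nletters_lt k.
by rewrite (IH _ kk t (leq_trans kk kt)) (IH _ kk k.+1 kk).
Qed.

Lemma solE k : sol k = W k + step k sol.
Proof.
rewrite {1}/sol -lock solfS; case: k => [//|k]; rewrite /step.
by rewrite (solfE (divn_nletters_lt k)).
Qed.

Lemma sol_uniq (Z : nat -> 'M[C]_(m, q)) :
  (forall k, Z k = W k + step k Z) -> forall k, Z k = sol k.
Proof.
move=> HZ; elim/ltn_ind => k IH; rewrite HZ solE; congr (_ + _).
by case: k IH => [//|k] IH /=; rewrite (IH _ (divn_nletters_lt k)).
Qed.

(** The absorption lemma with [q = 2 kap^-2 rho^2]; the smallness hypothesis is precisely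
    [nletters * q <= 1 / 2]. It yields both the boundedness of the resolvent and the summability of
    [Xi]. *)
Lemma sol_bound rho : 0 < kap -> opbounded x (rho ^+ 2) ->
  4 * nletters%:R * rho ^+ 2 <= kap ^+ 2 ->
  forall M, \sum_(0 <= k < M) frob2 (sol k) <= 4 * \sum_(0 <= k < M) frob2 (W k).
Proof.
move=> k0 xr Hr; apply: (@sum_tree_le _ _ _ (2 * kap ^- 2 * rho ^+ 2) nletters).
- exact: nletters_gt0.
- by move=> k; apply: frob2_ge0.
- by rewrite mulr_ge0 ?sqr_ge0 // mulr_ge0 ?ler0n // invr_ge0 sqr_ge0.
- by move=> k; apply: frob2_ge0.
- rewrite [leLHS](_ : _ = kap ^- 2 * (4 * nletters%:R * rho ^+ 2) / 2); last by field; rewrite gt_eqF.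
  by rewrite ler_pM2r ?invr_gt0 // mulrC ler_pdivrMr ?exprn_gt0 // mul1r.
- by rewrite solE /= addr0 ler_peMl ?frob2_ge0 // ler1n.
move=> k; rewrite solE /=; apply: (le_trans (frob2D_le2 _ _)); rewrite lerD2l.
rewrite frob2Z sqmod_real exprVn.
rewrite [leRHS](_ : _ = 2 * (kap ^- 2 * (rho ^+ 2 * frob2 (sol (k %/ nletters)%N)))); last by rewrite !mulrA.
rewrite ler_pM2l // ler_pM2l ?invr_gt0 ?exprn_gt0 //.
by apply: letx_bound; [exact: sqr_ge0 | exact: xr].
Qed.

End Recursion.

Lemma step_ext kap m q (x : coeffs R d n m) k (Z Z' : nat -> 'M[C]_(m, q)) :
  (forall l, Z l = Z' l) -> step kap x k Z = step kap x k Z'.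
Proof. by case: k => [//|k] H /=; rewrite H. Qed.

(** This is [kap^-|w| x^w] for the word [w] coded by the node. *)
Definition Xi kap m (x : coeffs R d n m) : nat -> 'M[C]_m :=
  sol kap x (fun k => if k == 0%N then 1%:M else 0).

Lemma sol_Xi kap m q (x : coeffs R d n m) (w : 'M[C]_(m, q)) k :
  sol kap x (fun k => if k == 0%N then w else 0) k = Xi kap x k *m w.
Proof.
symmetry; move: k.
apply: (@sol_uniq kap m q x (fun k => if k == 0%N then w else 0) (fun k => Xi kap x k *m w)) => k.
rewrite {1}/Xi solE mulmxDl; congr (_ + _).
  by case: eqP => _; rewrite (mul1mx, mul0mx).
by case: k => [|k] /=; rewrite ?mul0mx // -scalemxAl -mulmxA.
Qed.

Lemma Xi0 kap m (x : coeffs R d n m) : Xi kap x 0 = 1%:M.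
Proof. by rewrite /Xi solE /= addr0. Qed.

Lemma Xi_child kap m (x : coeffs R d n m) k j a b :
  Xi kap x (child k (rk j a b)) = (kap^-1)%:C%C *: (x j a b *m Xi kap x k).
Proof.
rewrite {1}/Xi solE /= add0r modnMDl divnMDl ?nletters_gt0 //.
by rewrite modn_small ?divn_small ?rk_lt // addn0 letx_rk.
Qed.

(** [kap] times the operator prepending a letter, compressed to the first [M] nodes. *)
Definition shift kap (M : nat) : coeffs R d n M := fun j a b =>
  \matrix_(k, l) (if (k == child l (rk j a b) :> nat) then kap%:C%C else 0).

(** Each column has at most one nonzero entry, and so has each row since prepending a fixed letter
    is injective. *)
Lemma shift_bound kap M : opbounded (shift kap M) (kap ^+ 2).
Proof.
move=> j a b v; set S := shift _ _ _ _ _; rewrite !frob2E.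
have H (k : 'I_M) : sqmod ((S *m v) k 0) <=
    \sum_(l < M) (k == child l (rk j a b) :> nat)%:R * (kap ^+ 2 * sqmod (v l 0)).
  have t0 (l : 'I_M) : 0 <= (k == child l (rk j a b) :> nat)%:R * (kap ^+ 2 * sqmod (v l 0)).
    by rewrite mulr_ge0 ?ler0n // mulr_ge0 ?sqr_ge0 ?sqmod_ge0.
  rewrite mxE; have [[l kl]|H] := pselect (exists l : 'I_M, k = child l (rk j a b) :> nat).
    rewrite (bigD1 l) //= [X in _ + X]big1 ?addr0 => [|l' ll'].
      rewrite mxE -kl eqxx sqmodM sqmod_real (bigD1 l) //= -kl eqxx mul1r lerDl.
      by apply: sumr_ge0.
    rewrite mxE; case: eqP => [kl'|_]; last by rewrite mul0r.
    by move: ll'; rewrite -val_eqE /= (child_inj (etrans (esym kl') kl)) eqxx.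
  rewrite big1 ?sqmod0 ?sumr_ge0 // => l _; rewrite mxE.
  by case: eqP => [kl|_]; [case: H; exists l | rewrite mul0r].
apply: (le_trans (ler_sum _ (fun k _ => H k))).
rewrite exchange_big mulr_sumr; apply: ler_sum => l _ /=.
rewrite -mulr_suml -[leRHS]mul1r ler_wpM2r //.
  by rewrite mulr_ge0 ?sqr_ge0 ?sqmod_ge0.
have [[k kl]|H'] := pselect (exists k : 'I_M, k = child l (rk j a b) :> nat).
  rewrite (bigD1 k) //= -kl eqxx big1 ?addr0 // => k' /negPf.
  by rewrite -val_eqE /= => ->.
rewrite big1 ?ler01 // => k _; case: eqP => // kl; by case: H'; exists k.
Qed.

Definition truncmx (M M' : nat) : 'M[C]_(M, M') := \matrix_(k, l) (k == l :> nat)%:R.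

Lemma truncmxl M M' q (A : 'M[C]_(M', q)) (k : 'I_M) (k' : 'I_M') l : k = k' :> nat ->
  (truncmx M M' *m A) k l = A k' l.
Proof.
move=> kk; rewrite mxE (bigD1 k') //= mxE kk eqxx mul1r big1 ?addr0 // => t /negPf tk.
by rewrite mxE kk eq_sym val_eqE tk mul0r.
Qed.

(** A parent precedes its children, so the first [M] rows of the larger shift are supported on the
    first [M] columns. *)
Lemma shift_trunc kap M M' j a b : (M <= M')%N ->
  shift kap M j a b *m truncmx M M' = truncmx M M' *m shift kap M' j a b.
Proof.
move=> MM'; apply/matrixP => k l.
rewrite (@truncmxl _ _ _ _ k (widen_ord MM' k)) // !mxE /=.
case: eqP => [kl|kl].
  have lM : (l < M)%N by rewrite (ltn_trans _ (ltn_ord k)) // kl ltn_child.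
  rewrite (bigD1 (Ordinal lM)) //= !mxE /= kl !eqxx mulr1 big1 ?addr0 // => t.
  by rewrite -val_eqE /= => /negPf tl; rewrite !mxE tl mulr0.
rewrite big1 // => t _; rewrite !mxE.
by case: eqP => [kt|_]; rewrite ?mul0r //; case: eqP => [tl|_]; rewrite ?mulr0 // -tl in kl *.
Qed.

End Tree.

(** * Entries of products with [T (x) 1] *)

Section TensorEntries.
Variable R : realType.
Local Notation C := R[i].

Lemma mulmx_tens1 p q m n (A : 'M[C]_(p, m * n)) (T : 'M[C]_(m, q)) s l i :
  (A *m (T *t (1%:M : 'M[C]_n))) s (mxtens_index (l, i)) =
  \sum_t A s (mxtens_index (t, i)) * T t l.
Proof.
rewrite mxE sum_mxtens; apply: eq_bigr => t _; rewrite (bigD1 i) //=.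
rewrite tensmxE mxE eqxx mulr1 big1 ?addr0 // => i' /negPf ii.
by rewrite tensmxE mxE ii !mulr0.
Qed.

Lemma mul_tens1mx p q m n (A : 'M[C]_(m * n, q)) (T : 'M[C]_(p, m)) s l a :
  ((T *t (1%:M : 'M[C]_n)) *m A) (mxtens_index (l, a)) s =
  \sum_t T l t * A (mxtens_index (t, a)) s.
Proof.
rewrite mxE sum_mxtens; apply: eq_bigr => t _; rewrite (bigD1 a) //=.
rewrite tensmxE mxE eqxx mulr1 big1 ?addr0 // => i' /negPf ii.
by rewrite tensmxE mxE eq_sym ii mulr0 mul0r.
Qed.

Lemma frob2_mul_delta p q (A : 'M[C]_(p, q)) j :
  frob2 (A *m delta_mx j (0 : 'I_1)) = \sum_i sqmod (A i j).
Proof. by rewrite -colE frob2E; apply: eq_bigr => i _; rewrite mxE. Qed.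

End TensorEntries.

(** * Series expansion of [f] near [Y] *)

Section Expansion.
Variable R : realType.
Local Notation C := R[i].
Variables (d n : nat) (Om : ncset R d) (f : ncfun R d) (Y : ncpt R d n).
Variables (r c del : R).
Hypotheses (Ods : ds_closed Om) (fnc : is_ncfun Om f) (r0 : 0 < r).
Hypothesis ballO : forall k (W : ncpt R d k), ubasic Y r W -> @Om k W.
Hypothesis ballf : forall k (W : ncpt R d k), ubasic Y r W -> opnorm_le (@f k W) c.
Hypothesis delE : ((d * n * n).+1)%:R * del = r / 2.

(** Halving leaves room for the off-diagonal block of the dilation: [del ^+ 2 = 4 * kap ^+ 2]. *)
Let kap := del / 2.

Lemma del_gt0 : 0 < del.
Proof.
have : 0 < ((d * n * n).+1)%:R * del by rewrite delE divr_gt0.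
by rewrite pmulr_rgt0 // ltr0Sn.
Qed.

Lemma opboundedW m (x : coeffs R d n m) s t :
  s <= t -> opbounded x s -> opbounded x t.
Proof.
move=> st xs j a b v; apply: (le_trans (xs j a b v)).
by rewrite ler_wpM2r ?frob2_ge0.
Qed.

Lemma f_emb_intertwine m m' (x : coeffs R d n m) (x' : coeffs R d n m')
  (T : 'M[C]_(m, m')) : (0 < m)%N -> (0 < m')%N ->
  opbounded x (del ^+ 2) -> opbounded x' (del ^+ 2) ->
  (forall j a b, x j a b *m T = T *m x' j a b) ->
  f (emb Y x) *m (T *t (1%:M : 'M[C]_n)) = (T *t 1%:M) *m f (emb Y x').
Proof.
move=> m0 m'0 bx bx' H; apply: (nc_intertwine Ods fnc).
- by apply: ballO; apply: emb_ubasic delE bx.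
- by apply: ballO; apply: emb_ubasic delE bx'.
- exact: emb_intertwine.
Qed.

Lemma f_emb_col_le m (x : coeffs R d n m) k :
  (0 < m)%N -> opbounded x (del ^+ 2) ->
  \sum_l sqmod (f (emb Y x) l k) <= c ^+ 2.
Proof.
move=> m0 bx; have /ballf/opnorm_leP H := emb_ubasic Y m0 r0 delE bx.
by have := H (delta_mx k 0); rewrite frob2_mul_delta frob2_delta mulr1.
Qed.

Lemma shift_opbounded M : opbounded (@shift R d n kap M) (del ^+ 2).
Proof.
apply: opboundedW (@shift_bound R d n kap M).
have := del_gt0; rewrite /kap; nra.
Qed.

(** The block [F_w] for the word coded by [k], read in the column of the empty word at the smallest
    truncation containing [k], where [k] is [ord_max]. *)
Definition fcoef (k : nat) : 'M[C]_n := \matrix_(a, i)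
  f (emb Y (@shift R d n kap k.+1)) (mxtens_index (ord_max, a)) (mxtens_index (ord0, i)).

(** Independence of the truncation: cutting down to the first [k.+1] nodes intertwines the two shift
    tuples, hence the two values of [f]. *)
Lemma fcoefE M (k : 'I_M.+1) a i :
  f (emb Y (@shift R d n kap M.+1)) (mxtens_index (k, a)) (mxtens_index (ord0, i)) =
  fcoef k a i.
Proof.
have := @f_emb_intertwine _ _ (@shift R d n kap k.+1) (@shift R d n kap M.+1)
  (truncmx R k.+1 M.+1) (ltn0Sn _) (ltn0Sn _) (@shift_opbounded _) (@shift_opbounded _)
  (fun j a b => shift_trunc kap j a b (ltn_ord k)).
move=> /matrixP/(_ (mxtens_index (ord_max, a)) (mxtens_index (ord0, i))).
rewrite mulmx_tens1 mul_tens1mx (bigD1 ord0) //= [in X in _ = X](bigD1 k) //=.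
rewrite !mxE /= !eqxx mulr1 mul1r big1 => [|t tn0].
  rewrite addr0 big1 ?addr0 => [|t /negPf tk]; first by move=> ->.
  by rewrite mxE eq_sym /= val_eqE tk mul0r.
by move: tn0; rewrite -val_eqE /= => /negPf tn0; rewrite mxE tn0 mulr0.
Qed.

(** All these blocks lie in one block column of a single value of [f], made of [n] columns of
    squared norm at most [c ^+ 2]. *)
Lemma fcoef_bound M : \sum_(0 <= k < M) frob2 (fcoef k) <= n%:R * c ^+ 2.
Proof.
case: M => [|M]; first by rewrite big_geq // mulr_ge0 ?sqr_ge0 ?ler0n.
rewrite big_mkord.
have -> : \sum_(k < M.+1) frob2 (fcoef k) = \sum_i \sum_l
    sqmod (f (emb Y (@shift R d n kap M.+1)) l (mxtens_index (ord0, i))).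
  under [RHS]eq_bigr do rewrite sum_mxtens.
  rewrite [RHS]exchange_big; apply: eq_bigr => k _ /=.
  rewrite exchange_big /=; apply: eq_bigr => a _; apply: eq_bigr => i _.
  by rewrite fcoefE.
rewrite -[X in X%:R]card_ord -sum1_card natr_sum mulr_suml; apply: ler_sum => i _.
by rewrite mul1r; apply: f_emb_col_le => //; apply: shift_opbounded.
Qed.

Variable (rho : R).
Hypothesis (rhoE : rho * (2 * (nletters d n)%:R) = kap).

Lemma rho_gt0 : 0 < rho.
Proof.
have : 0 < rho * (2 * (nletters d n)%:R) by rewrite rhoE; have := del_gt0; rewrite /kap; lra.
by rewrite pmulr_lgt0 // mulr_gt0 ?ltr0n // nletters_gt0.
Qed.

Lemma nletters_ge1 : 1 <= (nletters d n)%:R :> R.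
Proof. by rewrite ler1n nletters_gt0. Qed.

Lemma kap_gt0 : 0 < kap.
Proof. by have := del_gt0; rewrite /kap; lra. Qed.

(** Since [rho = kap / (2 N)] with [N] letters, the left side is [kap^2 / N]. This is the smallness
    required by [sol_bound]. *)
Lemma rho_kap : 4 * (nletters d n)%:R * rho ^+ 2 <= kap ^+ 2.
Proof.
have N1 := nletters_ge1; rewrite -rhoE !exprMn.
have -> : rho ^+ 2 * (2 ^+ 2 * (nletters d n)%:R ^+ 2) =
   4 * (nletters d n)%:R * rho ^+ 2 * (nletters d n)%:R by ring.
rewrite ler_peMr // mulr_ge0 ?sqr_ge0 // mulr_ge0 ?ler0n //.
Qed.

Lemma rho_kap2 : 4 * rho ^+ 2 <= kap ^+ 2.
Proof.
apply: (le_trans _ rho_kap); rewrite ler_wpM2r ?sqr_ge0 //.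
by have := nletters_ge1; lra.
Qed.

Variables (m : nat) (x : coeffs R d n m).
Hypotheses (m0 : (0 < m)%N) (bx : opbounded x (rho ^+ 2)).

Lemma x_opbounded : opbounded x (del ^+ 2).
Proof.
apply: opboundedW bx; have := rho_kap2; have := del_gt0.
rewrite /kap exprMn; have := sqr_ge0 rho; have := sqr_ge0 del; nra.
Qed.

Lemma Xi_bound M : \sum_(0 <= k < M) frob2 (Xi kap x k) <= 4 * m%:R.
Proof.
apply: (le_trans (@sol_bound _ _ _ kap _ _ x _ rho kap_gt0 bx rho_kap M)).
rewrite ler_pM2l //; case: M => [|M]; first by rewrite big_geq.
rewrite big_nat_recl // big1 => [|k _]; last by rewrite /= frob20.
rewrite /= addr0 /frob2 -[X in _ <= X%:R]card_ord -sum1_card natr_sum.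
apply: ler_sum => i _; rewrite (bigD1 i) //= mxE eqxx sqmod1 big1 ?addr0 //.
by move=> j /negPf ij; rewrite mxE eq_sym ij sqmod0.
Qed.

Section Dilation.
Variables (M : nat) (lam : R) (p : 'I_m).
Hypothesis lam0 : 0 < lam.
Hypothesis tail : forall M', \sum_(M.+1 <= k < M') frob2 (Xi kap x k) <= lam ^+ 2.

(** Column [k] is [kap^-|w| x^w e_p]. On the whole tree these columns would intertwine [x] with the
    shifts exactly; [Rem] is the defect of the truncation. *)
Let V0 : 'M[C]_(m, M.+1) := \matrix_(q, k) Xi kap x k q p.
Let Rem j a b := x j a b *m V0 - V0 *m @shift R d n kap M.+1 j a b.

(** Both products yield [kap] times the column of the child, except that the truncated shift loses
    the children beyond node [M]. *)
Lemma RemE j a b q (l : 'I_M.+1) : Rem j a b q l =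
  (M < child d n l (rk j a b))%:R * kap%:C%C * Xi kap x (child d n l (rk j a b)) q p.
Proof.
have k0 := kap_gt0.
have E : (x j a b *m V0) q l = kap%:C%C * Xi kap x (child d n l (rk j a b)) q p.
  rewrite Xi_child [in RHS]mxE mulrA -rmorphM mulfV ?gt_eqF // rmorph1 mul1r !mxE.
  by apply: eq_bigr => t _; rewrite mxE.
have -> : Rem j a b q l = (x j a b *m V0) q l - (V0 *m @shift R d n kap M.+1 j a b) q l.
  by rewrite /Rem [LHS]mxE; congr (_ + _); rewrite [LHS]mxE.
rewrite E [X in _ - X]mxE; case: ltnP => [Ml|lM].
  rewrite mul1r big1 ?subr0 // => t _; rewrite !mxE.
  case: (nat_of_ord t =P child d n l (rk j a b)) => [tl|_]; last by rewrite mulr0.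
  by rewrite -tl ltnNge -ltnS ltn_ord in Ml.
rewrite (bigD1 (Ordinal (lM : (child d n l (rk j a b) < M.+1)%N))) //= !mxE eqxx big1 => [|t].
  by rewrite addr0 !mul0r [_ * kap%:C%C]mulrC subrr.
by rewrite -val_eqE /= => /negPf tl; rewrite !mxE tl mulr0.
Qed.

(** For a fixed letter, distinct nodes have distinct children, so the surviving columns are distinct
    terms of the tail of [Xi]. *)
Lemma Rem_bound j a b : frob2 (Rem j a b) <= kap ^+ 2 * lam ^+ 2.
Proof.
pose g k := (M < k)%:R * frob2 (Xi kap x k).
have g0 k : 0 <= g k by rewrite mulr_ge0 ?ler0n ?frob2_ge0.
apply: (@le_trans _ _ (kap ^+ 2 * \sum_(0 <= l < M.+1) g (child d n l (rk j a b)))).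
  rewrite big_mkord /frob2 exchange_big mulr_sumr; apply: ler_sum => l _ /=.
  rewrite (eq_bigr (fun q => kap ^+ 2 * ((M < child d n l (rk j a b))%:R *
      sqmod (Xi kap x (child d n l (rk j a b)) q p)))) => [|q _]; last first.
    rewrite RemE !sqmodM sqmod_real; case: (M < _)%N => /=.
      by rewrite mulr1n sqmod1; ring.
    by rewrite mulr0n sqmod0; ring.
  rewrite -mulr_sumr ler_wpM2l ?sqr_ge0 // -mulr_sumr ler_wpM2l ?ler0n //.
  apply: ler_sum => q _; rewrite (bigD1 p) //= lerDl.
  by apply: sumr_ge0 => *; apply: sqmod_ge0.
rewrite ler_wpM2l ?sqr_ge0 //.
apply: (le_trans (sum_incr_le (c := fun l => child d n l (rk j a b)) _ g0 _)) => [k|].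
  exact: child_incr.
set M' := child _ _ _ _; have [MM'|M'M] := leqP M.+1 M'.
  apply: le_trans (tail M'); rewrite (big_cat_nat (leq0n M.+1) MM') //= big_nat big1 ?add0r.
    rewrite big_nat [leRHS]big_nat; apply: ler_sum => k /andP[Mk _].
    by rewrite /g Mk mul1r.
  by move=> k /andP[_ kM]; rewrite /g ltnNge -ltnS kM mul0r.
rewrite big_nat big1 ?sqr_ge0 // => k /andP[_ kM].
by rewrite /g ltnNge ltnW ?mul0r // (leq_trans kM).
Qed.

Let dil : coeffs R d n (M.+1 + m) := fun j a b =>
  block_mx (@shift R d n kap M.+1 j a b) 0 ((lam^-1)%:C%C *: Rem j a b) (x j a b).

(** The factor [lam^-1] cancels the [lam] of [Rem_bound], so the corner has Frobenius norm at most
    [kap]. With [rho <= kap] the total is at most [3 kap^2 |y|^2 + 2 kap^2 |z|^2]. *)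
Lemma dil_opbounded : opbounded dil (del ^+ 2).
Proof.
move=> j a b v; rewrite -[v]vsubmxK /dil mul_block_col mul0mx addr0.
set y := usubmx v; set z := dsubmx v; rewrite !frob2_col_mx.
have H1 := @shift_bound R d n kap M.+1 j a b y.
have H2 := frob2D_le2 ((lam^-1)%:C%C *: Rem j a b *m y) (x j a b *m z).
have H3 := bx j a b z.
have H4 : frob2 ((lam^-1)%:C%C *: Rem j a b *m y) <= kap ^+ 2 * frob2 y.
  apply: (le_trans (frob2_mul _ _)); rewrite ler_wpM2r ?frob2_ge0 //.
  rewrite frob2Z sqmod_real exprVn mulrC ler_pdivrMr ?exprn_gt0 //.
  exact: Rem_bound.
have H5 := rho_kap2; have y0 := frob2_ge0 y; have z0 := frob2_ge0 z.
have dE : del ^+ 2 = 4 * kap ^+ 2 by rewrite /kap; field.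
rewrite dE.
have H6 : rho ^+ 2 * frob2 z <= kap ^+ 2 * frob2 z.
  by rewrite ler_wpM2r //; have := sqr_ge0 rho; lra.
have H7 : 0 <= kap ^+ 2 * frob2 y by rewrite mulr_ge0 ?sqr_ge0.
have H8 : 0 <= kap ^+ 2 * frob2 z by rewrite mulr_ge0 ?sqr_ge0.
rewrite (_ : 4 * kap ^+ 2 * (frob2 y + frob2 z) =
  4 * (kap ^+ 2 * frob2 y) + 4 * (kap ^+ 2 * frob2 z)); last by ring.
move: H1 H2 H3 H4 H6 H7 H8.
move: (kap ^+ 2 * frob2 y) (kap ^+ 2 * frob2 z) (rho ^+ 2 * frob2 z) => a1 a2 a3.
move: (frob2 _) (frob2 _) (frob2 _) (frob2 _) => a4 a5 a6 a7; lra.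
Qed.

Lemma f_emb_approx q a i :
  sqmod (f (emb Y x) (mxtens_index (q, a)) (mxtens_index (p, i)) -
    \sum_(0 <= k < M.+1) Xi kap x k q p * fcoef k a i) <= lam ^+ 2 * c ^+ 2.
Proof.
pose G (t : 'I_(M.+1 + m)) :=
  f (emb Y dil) (mxtens_index (t, a)) (mxtens_index (lshift m (ord0 : 'I_M.+1), i)).
have dil0 : (0 < M.+1 + m)%N by [].
have GE (k : 'I_M.+1) : G (lshift m k) = fcoef k a i.
  (* The dilation is block lower triangular, so [(1, 0)] intertwines the shifts with it; this
     identifies the upper blocks of [f] at the dilation. *)
  have SQ j0 a0 b0 : @shift R d n kap M.+1 j0 a0 b0 *m row_mx 1%:M 0 =
      row_mx 1%:M 0 *m dil j0 a0 b0.
    by rewrite /dil mul_row_block mul_mx_row !(mulmx1, mulmx0, mul1mx, mul0mx, addr0).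
  have := f_emb_intertwine (ltn0Sn _) dil0 (@shift_opbounded _) (@dil_opbounded) SQ.
  move=> /matrixP/(_ (mxtens_index (k, a)) (mxtens_index (lshift m ord0, i))).
  move=> /esym; rewrite mul_tens1mx mulmx_tens1 (bigD1 (lshift m k)) //=.
  rewrite row_mxEl mxE eqxx mul1r big1 => [|t tk]; last first.
    case: (split_ordP t) tk => t' ->; last by rewrite row_mxEr mxE mul0r.
    by rewrite row_mxEl mxE (inj_eq (@lshift_inj _ _)) eq_sym => /negPf ->; rewrite mul0r.
  rewrite addr0 /G => ->; rewrite (bigD1 ord0) //= row_mxEl mxE eqxx mulr1 fcoefE.
  rewrite big1 ?addr0 // => t /negPf tn0.
  by rewrite row_mxEl mxE tn0 mulr0.
(* [lam] times the corner [lam^-1 Rem] supplies exactly the defect of [V0]. *)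
have XV j0 a0 b0 : x j0 a0 b0 *m row_mx V0 (lam%:C%C)%:M =
    row_mx V0 (lam%:C%C)%:M *m dil j0 a0 b0.
  rewrite /dil mul_row_block mul_mx_row mulmx0 add0r !mul_scalar_mx mul_mx_scalar.
  congr (row_mx _ _); rewrite scalerA -rmorphM mulfV ?gt_eqF //.
  by rewrite rmorph1 scale1r /Rem addrC subrK.
have := f_emb_intertwine m0 dil0 (@x_opbounded) (@dil_opbounded) XV.
move=> /matrixP/(_ (mxtens_index (q, a)) (mxtens_index (lshift m ord0, i))).
(* In the column of the empty word, [V0] is [e_p], because [Xi] is the identity at the root. *)
rewrite mulmx_tens1 mul_tens1mx (bigD1 p) //= row_mxEl mxE Xi0 mxE eqxx mulr1.
rewrite big1 ?addr0 => [->|t /negPf tp]; last first.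
  by rewrite row_mxEl mxE Xi0 mxE tp mulr0.
rewrite big_split_ord /=.
rewrite (eq_bigr (fun k : 'I_M.+1 => Xi kap x k q p * fcoef k a i)) => [|k _]; last first.
  by rewrite row_mxEl mxE -GE.
rewrite big_mkord [X in sqmod X]addrC addKr (bigD1 q) //= row_mxEr mxE eqxx big1 ?addr0 => [|t]; last first.
  by rewrite eq_sym => /negPf tq; rewrite row_mxEr mxE tq mul0r.
(* What is left is [lam] times one entry of [f] at the dilation, bounded by its column. *)
rewrite mulr1n sqmodM sqmod_real ler_wpM2l ?sqr_ge0 //.
apply: le_trans (f_emb_col_le (mxtens_index (lshift m ord0, i)) dil0 (@dil_opbounded)).
rewrite (bigD1 (mxtens_index (rshift M.+1 q, a))) //= lerDl.
by apply: sumr_ge0 => *; apply: sqmod_ge0.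
Qed.

End Dilation.

Lemma f_emb_expansion p q a i e : 0 < e ->
  exists M0, forall M, (M0 <= M)%N ->
  sqmod (f (emb Y x) (mxtens_index (q, a)) (mxtens_index (p, i)) -
    \sum_(0 <= k < M) Xi kap x k q p * fcoef k a i) <= e.
Proof.
(* The error becomes [e c^2 / (1 + c^2) <= e]; the [1] covers [c = 0]. *)
move=> e0; pose lam2 := e / (1 + c ^+ 2).
have c1 : 0 < 1 + c ^+ 2 by rewrite ltr_pwDl // sqr_ge0.
have l0 : 0 < lam2 by rewrite divr_gt0.
have [M0 HM] := psum_tail (fun k => frob2_ge0 (Xi kap x k)) Xi_bound l0.
exists M0.+1 => -[//|M] MM.
have s0 : 0 < Num.sqrt lam2 by rewrite sqrtr_gt0.
have T M' : \sum_(M.+1 <= k < M') frob2 (Xi kap x k) <= Num.sqrt lam2 ^+ 2.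
  by rewrite sqr_sqrtr ?(ltW l0) //; apply: HM; apply: ltnW.
apply: (le_trans (f_emb_approx p s0 T q a i)).
rewrite sqr_sqrtr ?(ltW l0) // /lam2 mulrAC ler_pdivrMr // ler_wpM2l ?(ltW e0) //.
by rewrite lerDr ler01.
Qed.

End Expansion.

(** * Limits of real and complex sequences *)

Section ComplexLimits.
Variable R : realType.
Local Notation C := R[i].

(** The limit is the supremum of the eventual lower bounds of the sequence. *)
Lemma real_cauchy (a : nat -> R) :
  (forall e, 0 < e -> exists N, forall p q, (N <= p)%N -> (N <= q)%N -> `|a p - a q| <= e) ->
  exists l, forall e, 0 < e -> exists N, forall p, (N <= p)%N -> `|a p - l| <= e.
Proof.
move=> Ha; pose E : set R := fun x => exists N, forall p, (N <= p)%N -> x <= a p.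
have [N0 HN0] := Ha 1 ltr01.
have EN e N : (forall p q, (N <= p)%N -> (N <= q)%N -> `|a p - a q| <= e) -> E (a N - e).
  move=> H; exists N => p Np; have := H N p (leqnn _) Np; rewrite ler_norml => /andP[_]; lra.
have UN e N x : (forall p q, (N <= p)%N -> (N <= q)%N -> `|a p - a q| <= e) ->
    E x -> x <= a N + e.
  move=> H [N' HN']; apply: (le_trans (HN' (maxn N N') (leq_maxr _ _))).
  by have := H (maxn N N') N (leq_maxl _ _) (leqnn _); rewrite ler_norml => /andP[_]; lra.
have hE : has_sup E by split; [exists (a N0 - 1); exact: EN | exists (a N0 + 1) => x; exact: UN].
exists (sup E) => e e0; have e2 : 0 < e / 2 by rewrite divr_gt0.
have [N HN] := Ha _ e2; exists N => p Np.
have h1 : a N - e / 2 <= sup E by apply: ub_le_sup; [case: hE | exact: EN].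
have h2 : sup E <= a N + e / 2 by apply: ge_sup; [case: hE | move=> x; exact: UN].
have := HN p N Np (leqnn _); rewrite !ler_norml => /andP[h3 h4]; apply/andP; split; lra.
Qed.

Definition ccvg (s : nat -> C) (l : C) := forall e : R, 0 < e ->
  exists N, forall p, (N <= p)%N -> sqmod (s p - l) <= e.

Lemma sqmod_le_abs (z : C) (e : R) : 0 <= e ->
  sqmod z <= e ^+ 2 -> `|complex.Re z| <= e /\ `|complex.Im z| <= e.
Proof.
move=> e0; have a2 := sqr_ge0 (complex.Re z); have b2 := sqr_ge0 (complex.Im z).
rewrite /sqmod => H; split; rewrite -(ler_pXn2r (ltn0Sn 1)) ?nnegrE ?normr_ge0 //;
  rewrite real_normK ?num_real //; lra.
Qed.

Lemma ccauchy (s : nat -> C) :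
  (forall e, 0 < e -> exists N, forall p q, (N <= p)%N -> (N <= q)%N -> sqmod (s p - s q) <= e) ->
  exists l, ccvg s l.
Proof.
move=> Hs.
have Hre : exists l, forall e, 0 < e -> exists N, forall p, (N <= p)%N ->
    `|complex.Re (s p) - l| <= e.
  apply: real_cauchy => e e0; have [N HN] := Hs _ (exprn_gt0 2 e0).
  exists N => p q Np Nq; have [+ _] := sqmod_le_abs (ltW e0) (HN p q Np Nq).
  by case: (s p) (s q) => [? ?] [? ?].
have Him : exists l, forall e, 0 < e -> exists N, forall p, (N <= p)%N ->
    `|complex.Im (s p) - l| <= e.
  apply: real_cauchy => e e0; have [N HN] := Hs _ (exprn_gt0 2 e0).
  exists N => p q Np Nq; have [_ +] := sqmod_le_abs (ltW e0) (HN p q Np Nq).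
  by case: (s p) (s q) => [? ?] [? ?].
have [a Ha] := Hre; have [b Hb] := Him; exists (Complex a b) => e e0.
pose e' := Num.sqrt (e / 2).
have e'0 : 0 < e' by rewrite sqrtr_gt0 divr_gt0.
have e'2 : e' ^+ 2 = e / 2 by rewrite sqr_sqrtr // divr_ge0 // ltW.
have [N1 H1] := Ha _ e'0; have [N2 H2] := Hb _ e'0.
exists (maxn N1 N2) => p; rewrite geq_max => /andP[/H1 + /H2].
case: (s p) => x y /= h1 h2; rewrite /sqmod /=.
have -> : e = e' ^+ 2 + e' ^+ 2 by rewrite e'2; lra.
have K (t : R) : `|t| <= e' -> t ^+ 2 <= e' ^+ 2.
  by move=> h; rewrite -real_normK ?num_real // lerXn2r ?nnegrE ?normr_ge0 // ltW.
by apply: lerD; apply: K.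
Qed.

Lemma ccvg_unique s l l' : ccvg s l -> ccvg s l' -> l = l'.
Proof.
move=> H H'; apply/eqP; rewrite -subr_eq0; apply/eqP/sqmod_eq0/eqP.
rewrite eq_le sqmod_ge0 andbT; apply/ler_addgt0Pr => e e0; rewrite add0r.
have e4 : 0 < e / 4 by rewrite divr_gt0.
have [N1 H1] := H _ e4; have [N2 H2] := H' _ e4.
have h1 := H1 (maxn N1 N2) (leq_maxl _ _); have h2 := H2 (maxn N1 N2) (leq_maxr _ _).
have -> : l - l' = - (s (maxn N1 N2) - l) + (s (maxn N1 N2) - l') by ring.
apply: (le_trans (sqmodD_le2 _ _)); rewrite sqmodN; lra.
Qed.

Lemma ccvg_ext s t l : (forall p, s p = t p) -> ccvg s l -> ccvg t l.
Proof. by move=> st H e /H[N HN]; exists N => p /HN; rewrite st. Qed.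

Lemma ccvg0 : ccvg (fun=> 0) 0.
Proof. by move=> e e0; exists 0%N => p _; rewrite subr0 sqmod0 ltW. Qed.

Lemma ccvgD s t l l' : ccvg s l -> ccvg t l' -> ccvg (fun p => s p + t p) (l + l').
Proof.
move=> H H' e e0; have e4 : 0 < e / 4 by rewrite divr_gt0.
have [N1 H1] := H _ e4; have [N2 H2] := H' _ e4.
exists (maxn N1 N2) => p; rewrite geq_max => /andP[/H1 h1 /H2 h2].
have -> : s p + t p - (l + l') = (s p - l) + (t p - l') by ring.
apply: (le_trans (sqmodD_le2 _ _)); lra.
Qed.

Lemma ccvgZ a s l : ccvg s l -> ccvg (fun p => a * s p) (a * l).
Proof.
move=> H e e0; have a1 : 0 < 1 + sqmod a by rewrite ltr_pwDl ?sqmod_ge0.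
have [N HN] := H _ (divr_gt0 e0 a1); exists N => p /HN; rewrite -mulrBr sqmodM.
rewrite ler_pdivlMr // mulrC => h; apply: (le_trans _ h).
by rewrite ler_wpM2r ?sqmod_ge0 // lerDr ler01.
Qed.

Lemma ccvg_conj s l : ccvg s l -> ccvg (fun p => Num.conj (s p)) (Num.conj l).
Proof. by move=> H e /H[N HN]; exists N => p /HN; rewrite -rmorphB sqmod_conj. Qed.

Lemma ccvg_sum (I : Type) (r : seq I) (s : I -> nat -> C) (l : I -> C) :
  (forall i, ccvg (s i) (l i)) ->
  ccvg (fun p => \sum_(i <- r) s i p) (\sum_(i <- r) l i).
Proof.
move=> H; elim: r => [|i r IH].
  by rewrite big_nil; apply: ccvg_ext ccvg0 => p; rewrite big_nil.
rewrite big_cons; apply: ccvg_ext (ccvgD (H i) IH) => p.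
by rewrite big_cons.
Qed.

Lemma psum_ccvg (a : nat -> R) B : (forall k, 0 <= a k) ->
  (forall M, \sum_(0 <= k < M) a k <= B) ->
  exists l : R, [/\ ccvg (fun M => (\sum_(0 <= k < M) a k)%:C%C) l%:C%C,
    forall M, \sum_(0 <= k < M) a k <= l &
    forall B', (forall M, \sum_(0 <= k < M) a k <= B') -> l <= B'].
Proof.
move=> a0 aB; pose E : set R := fun y => exists M, y = \sum_(0 <= k < M) a k.
have hE : has_sup E.
  split; first by exists (\sum_(0 <= k < 0) a k), 0%N.
  by exists B => _ [M ->].
have ub M : \sum_(0 <= k < M) a k <= sup E.
  by apply: ub_le_sup; [case: hE | exists M].
exists (sup E); split=> // [e e0|B' HB']; last first.
  by apply: ge_sup; [case: hE | move=> _ [M ->]].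
have s0 : 0 < Num.sqrt e by rewrite sqrtr_gt0.
have [_ [N ->] HN] := sup_adherent s0 hE.
exists N => p Np; rewrite -rmorphB sqmod_real -[leRHS](sqr_sqrtr (ltW e0)).
have h : \sum_(0 <= k < N) a k <= \sum_(0 <= k < p) a k by exact: ler_psum_nat.
rewrite -sqrrN lerXn2r ?nnegrE ?(ltW s0) // opprB ?subr_ge0 //.
move: h HN; lra.
Qed.

(** One-sided, as it is applied to sums of squared moduli. *)
Definition tends0 (a : nat -> R) := forall e, 0 < e ->
  exists N, forall p, (N <= p)%N -> a p <= e.

Lemma tends0_sum (I : Type) (r : seq I) (a : I -> nat -> R) :
  (forall i, tends0 (a i)) -> tends0 (fun p => \sum_(i <- r) a i p).
Proof.
move=> H; elim: r => [|i r IH] e e0.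
  by exists 0%N => p _; rewrite big_nil ltW.
have e2 : 0 < e / 2 by rewrite divr_gt0.
have [N1 H1] := H i _ e2; have [N2 H2] := IH _ e2.
exists (maxn N1 N2) => p; rewrite geq_max => /andP[/H1 h1 /H2 h2].
by rewrite big_cons; move: h1 h2; lra.
Qed.

End ComplexLimits.

(** * The space of square-summable vector sequences *)

Section L2.
Variables (R : realType) (n : nat).
Local Notation C := R[i].
Implicit Types u v : nat -> 'cV[C]_n.

Definition psum u (M : nat) : R := \sum_(0 <= k < M) frob2 (u k).

Definition l2_pred : {pred nat -> 'cV[C]_n} :=
  fun u => `[< exists B, forall M, psum u M <= B >].

Lemma psum_ge0 u M : 0 <= psum u M.
Proof. by apply: sumr_ge0 => *; apply: frob2_ge0. Qed.

Lemma psumD_le u v M : psum (u + v) M <= 2 * psum u M + 2 * psum v M.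
Proof.
rewrite /psum !mulr_sumr -big_split; apply: ler_sum => k _; exact: frob2D_le2.
Qed.

Lemma psumZ a u M : psum (a *: u) M = sqmod a * psum u M.
Proof. rewrite /psum mulr_sumr; apply: eq_bigr => k _; exact: frob2Z. Qed.

Lemma l2_submod : submod_closed l2_pred.
Proof.
split=> [|a u v /asboolP[B HB] /asboolP[B' HB']]; apply/asboolP.
  by exists 0 => M; rewrite /psum big1 // => k _; exact: frob20.
exists (2 * (sqmod a * B) + 2 * B') => M; apply: (le_trans (psumD_le _ _ _)).
apply: lerD; rewrite ler_pM2l // psumZ ler_wpM2l ?sqmod_ge0 //.
Qed.

HB.instance Definition _ :=
  GRing.isSubmodClosed.Build C (nat -> 'cV[C]_n) l2_pred l2_submod.

Record l2 := L2 { l2val :> nat -> 'cV[C]_n; _ : l2val \in l2_pred }.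
HB.instance Definition _ := [isSub for l2val].
HB.instance Definition _ := [Choice of l2 by <:].
HB.instance Definition _ := [SubChoice_isSubLmodule of l2 by <:].

End L2.

(** * Inner product and completeness *)

Section L2Hilbert.
Variables (R : realType) (n : nat).
Local Notation C := R[i].
Local Notation H := (l2 R n).
Implicit Types x y z : H.

Lemma l2valP x : exists B, forall M, psum x M <= B.
Proof. by case: x => u ux; apply/asboolP. Qed.

(** The default [0] is taken off the square-summable sequences; [mkl2E] excludes that case from a
    bound on partial sums. *)
Definition mkl2 (u : nat -> 'cV[C]_n) : H := insubd 0 u.

Lemma mkl2E (u : nat -> 'cV[C]_n) B : (forall M, psum u M <= B) ->
  l2val (mkl2 u) = u.
Proof. by move=> uB; rewrite /mkl2 -[l2val _]/(val _) insubdK //; apply/asboolP; exists B. Qed.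

Lemma l2_inj x y : (forall k, x k = y k) -> x = y.
Proof. by move=> xy; apply: val_inj; apply: funext. Qed.

Lemma l2D x y k : (x + y) k = x k + y k.
Proof. by []. Qed.

Lemma l2B x y k : (x - y) k = x k - y k.
Proof. by []. Qed.

Lemma l2Z a x k : (a *: x) k = a *: x k.
Proof. by []. Qed.

Lemma l2_sum (I : Type) (r : seq I) (F : I -> H) k :
  (\sum_(i <- r) F i) k = \sum_(i <- r) F i k.
Proof. by elim: r => [|i r IH]; rewrite ?big_nil // !big_cons l2D IH. Qed.

Lemma l2norm_ex x : exists l : R, [/\ ccvg (fun M => (psum x M)%:C%C) l%:C%C,
    forall M, psum x M <= l & forall B, (forall M, psum x M <= B) -> l <= B].
Proof.
have [B HB] := l2valP x.
exact: (psum_ccvg (fun k => frob2_ge0 (x k)) HB).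
Qed.

Definition l2norm2 x : R := projT1 (cid (l2norm_ex x)).

Lemma l2norm2_cvg x : ccvg (fun M => (psum x M)%:C%C) (l2norm2 x)%:C%C.
Proof. by rewrite /l2norm2; case: cid => l []. Qed.

Lemma psum_le_l2norm2 x M : psum x M <= l2norm2 x.
Proof. by rewrite /l2norm2; case: cid => l []. Qed.

Lemma l2norm2_le x B : (forall M, psum x M <= B) -> l2norm2 x <= B.
Proof. by rewrite /l2norm2; case: cid => l [] //= _ _; apply. Qed.

Lemma l2norm2_ge0 x : 0 <= l2norm2 x.
Proof. exact: le_trans (psum_ge0 x 0) (psum_le_l2norm2 x 0). Qed.

Lemma frob2_le_l2norm2 x k : frob2 (x k) <= l2norm2 x.
Proof.
apply: le_trans (psum_le_l2norm2 x k.+1); rewrite /psum big_nat_recr //= lerDr.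
by apply: sumr_ge0 => *; apply: frob2_ge0.
Qed.

Definition l2dot (u v : nat -> 'cV[C]_n) (M : nat) : C := \sum_(0 <= k < M) cip (u k) (v k).

(** Cauchy-Schwarz on a segment of the sum: the segment of [x] is small and that of [y] is at most
    its full norm. *)
Lemma l2ip_ex x y : exists l, ccvg (l2dot x y) l.
Proof.
apply: ccauchy => e e0.
have b1 : 0 < 1 + l2norm2 y by rewrite ltr_pwDl ?l2norm2_ge0.
have e1 : 0 < e / (1 + l2norm2 y) by rewrite divr_gt0.
have [N HN] := psum_tail (fun k => frob2_ge0 (x k)) (psum_le_l2norm2 x) e1.
exists N.
have key p q : (N <= p)%N -> (p <= q)%N -> sqmod (l2dot x y q - l2dot x y p) <= e.
  move=> Np pq; rewrite /l2dot (big_cat_nat (leq0n p) pq) //= [X in sqmod X]addrC addKr.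
  apply: (@le_trans _ _ ((\sum_(p <= k < q) frob2 (x k)) * (\sum_(p <= k < q) frob2 (y k)))).
    by apply: sqmod_sum_mul_le => k; rewrite ?frob2_ge0 ?cip_le.
  apply: (@le_trans _ _ (e / (1 + l2norm2 y) * (1 + l2norm2 y))); last first.
    by rewrite divfK ?gt_eqF.
  apply: ler_pM; [| | exact: HN |]; try by apply: sumr_ge0 => *; apply: frob2_ge0.
  apply: (@le_trans _ _ (psum y q)).
    rewrite /psum (big_cat_nat (leq0n p) pq) //= lerDr.
    by apply: sumr_ge0 => *; apply: frob2_ge0.
  by apply: (le_trans (psum_le_l2norm2 y q)); rewrite lerDr ler01.
move=> p q Np Nq; have [pq|/ltnW qp] := leqP p q; last exact: key.
by rewrite -sqmodN opprB; apply: key.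
Qed.

Definition l2ip x y : C := projT1 (cid (l2ip_ex x y)).

Lemma l2ip_cvg x y : ccvg (l2dot x y) (l2ip x y).
Proof. by rewrite /l2ip; case: cid. Qed.

Lemma l2ip_self x : l2ip x x = (l2norm2 x)%:C%C.
Proof.
apply: (ccvg_unique (l2ip_cvg x x)); apply: ccvg_ext (l2norm2_cvg x) => M.
rewrite /psum /l2dot rmorph_sum; apply: eq_bigr => k _.
exact: (esym (vnorm2E _)).
Qed.

Lemma cipDl p (a : C) (u v w : 'cV[C]_p) : cip (a *: u + v) w = a * cip u w + cip v w.
Proof.
rewrite /cip mulr_sumr -big_split; apply: eq_bigr => i _ /=.
by rewrite !mxE mulrDl mulrA.
Qed.

Lemma cip_conj p (u v : 'cV[C]_p) : cip v u = Num.conj (cip u v).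
Proof.
rewrite /cip rmorph_sum; apply: eq_bigr => i _.
by rewrite rmorphM /= conjCK mulrC.
Qed.

(** The limit [L] is taken coordinatewise; the Cauchy bound passes to [L] on each finite partial
    sum, uniformly in its length. *)
Lemma l2_complete (u : nat -> H) : ip_cauchy l2ip u -> exists l, ip_cvg l2ip u l.
Proof.
move=> Hu.
have Hn (e : R) : 0 < e -> exists N, forall p q, (N <= p)%N -> (N <= q)%N ->
    l2norm2 (u p - u q) <= e.
  move=> e0; have e0' : 0 < e%:C%C by rewrite ltcR.
  have [N HN] := Hu _ e0'; exists N => p q Np Nq.
  by have := HN p q Np Nq; rewrite l2ip_self ltcR => /ltW.
have Hc k i : exists l, ccvg (fun p => u p k i 0) l.
  apply: ccauchy => e /Hn[N HN]; exists N => p q Np Nq.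
  apply: le_trans (HN p q Np Nq); apply: le_trans (frob2_le_l2norm2 _ k).
  by have := sqmod_le_frob2 ((u p - u q) k) i 0; rewrite l2B !mxE.
pose L k : 'cV[C]_n := \col_i projT1 (cid (Hc k i)).
have HL k i : ccvg (fun p => u p k i 0) (L k i 0) by rewrite mxE; case: cid.
have HM M : tends0 (fun q => psum (l2val (u q) - L) M).
  apply: tends0_sum => k; apply: tends0_sum => i; apply: tends0_sum => j e e0.
  have [N HN] := HL k i e e0; exists N => p /HN.
  by rewrite !mxE ord1.
have bnd (e : R) : 0 < e -> exists N, forall p, (N <= p)%N -> forall M,
    psum (l2val (u p) - L) M <= e.
  move=> e0; have e4 : 0 < e / 4 by rewrite divr_gt0.
  have [N HN] := Hn _ e4; exists N => p Np M.
  have [Q HQ] := HM M _ e4.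
  (* The auxiliary index [Q] depends on [M], but the resulting bound [e] does not. *)
  have -> : l2val (u p) - L = l2val (u p - u (maxn N Q)) + (l2val (u (maxn N Q)) - L).
    by apply: funext => k; rewrite !fctE l2B addrA subrK.
  apply: (le_trans (psumD_le _ _ _)).
  have h1 := HQ (maxn N Q) (leq_maxr _ _).
  have h2 := le_trans (psum_le_l2norm2 _ M) (HN p (maxn N Q) Np (leq_maxl _ _)).
  move: h1 h2; lra.
have [N HN] := bnd 1 ltr01.
have LB M : psum L M <= 2 * 1 + 2 * l2norm2 (u N).
  have -> : L = (-1) *: (l2val (u N) - L) + l2val (u N).
    by apply: funext => k; rewrite !fctE scaleN1r opprB subrK.
  apply: (le_trans (psumD_le _ _ _)); rewrite psumZ sqmodN sqmod1 mul1r.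
  by have := HN N (leqnn _) M; have := psum_le_l2norm2 (u N) M; lra.
(* A positive complex [eps] is real; half of it turns the weak bound into the strict one. *)
exists (mkl2 L) => eps; rewrite ltcE /= => /andP[/eqP epsI eps0].
have [N' HN'] := bnd _ (divr_gt0 eps0 (ltr0Sn _ 1)).
exists N' => p Np; rewrite l2ip_self ltcE /= epsI eqxx /=.
have : l2norm2 (u p - mkl2 L) <= complex.Re eps / 2.
  apply: l2norm2_le => M; suff <- : l2val (u p) - L = l2val (u p - mkl2 L) by exact: HN'.
  by apply: funext => k; rewrite l2B (mkl2E LB).
by move: eps0; lra.
Qed.

Lemma l2_hilbert : hilbert l2ip.
Proof.
split.
- move=> a x y z; apply: (ccvg_unique (l2ip_cvg _ _)).
  apply: ccvg_ext (ccvgD (ccvgZ a (l2ip_cvg x z)) (l2ip_cvg y z)) => M.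
  rewrite /l2dot mulr_sumr -big_split; apply: eq_bigr => k _ /=.
  by rewrite -cipDl.
- move=> x y; apply: (ccvg_unique (l2ip_cvg _ _)).
  apply: ccvg_ext (ccvg_conj (l2ip_cvg x y)) => M.
  by rewrite /l2dot rmorph_sum; apply: eq_bigr => k _; exact/esym/cip_conj.
- by move=> x; rewrite l2ip_self ler0c l2norm2_ge0.
- move=> x; rewrite l2ip_self => -[x0]; apply: l2_inj => k; apply: frob2_eq0.
  by apply/eqP; rewrite eq_le frob2_ge0 andbT -x0 frob2_le_l2norm2.
- exact: l2_complete.
Qed.

End L2Hilbert.

(** * State, input and output operators, and the resolvent *)

Section Realization.
Variables (R : realType) (d n : nat).
Local Notation C := R[i].
Local Notation H := (l2 R n).
Local Notation N := (nletters d n).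

Lemma bdd_lin_l2 (T : H -> H) (K : R) : 0 <= K ->
  (forall a x y, T (a *: x + y) = a *: T x + T y) ->
  (forall x, l2norm2 (T x) <= K * l2norm2 x) -> bdd_lin (@l2ip R n) (@l2ip R n) T.
Proof.
move=> K0 Tl TK; split=> //; exists (Num.sqrt K) => x.
by rewrite !l2ip_self sqr_sqrtr // -rmorphM lecR.
Qed.

Lemma bdd_lin_cip_l2 (T : 'cV[C]_n -> H) (K : R) : 0 <= K ->
  (forall a x y, T (a *: x + y) = a *: T x + T y) ->
  (forall v, l2norm2 (T v) <= K * frob2 v) -> bdd_lin (@cip R n) (@l2ip R n) T.
Proof.
move=> K0 Tl TK; split=> //; exists (Num.sqrt K) => x.
rewrite l2ip_self sqr_sqrtr // -[cip x x]/(vnorm2 x) vnorm2E -rmorphM lecR.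
exact: TK.
Qed.

Section StateOperators.
Variable kap : R.

Definition letcoef (j : 'I_d) (M : 'M[C]_n) (i : nat) : C :=
  \sum_a \sum_b (rk j a b == i)%:R * M a b.

Lemma letcoefD j i a M1 M2 :
  letcoef j (a *: M1 + M2) i = a * letcoef j M1 i + letcoef j M2 i.
Proof.
rewrite /letcoef mulr_sumr -big_split; apply: eq_bigr => s _ /=.
rewrite mulr_sumr -big_split; apply: eq_bigr => t _ /=.
by rewrite !mxE mulrDr mulrCA.
Qed.

Lemma letcoef_le j M i : sqmod (letcoef j M i) <= n%:R * (n%:R * frob2 M).
Proof.
apply: (le_trans (sqmod_sum_le _)); rewrite card_ord ler_wpM2l ?ler0n //.
rewrite mulr_sumr; apply: ler_sum => a _.
apply: (le_trans (sqmod_sum_le _)); rewrite card_ord ler_wpM2l ?ler0n //.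
apply: ler_sum => b _; case: (rk j a b == i); first by rewrite mul1r.
by rewrite mul0r sqmod0 sqmod_ge0.
Qed.

(** This is [kap^-1] times the sum over [a, b] of [M a b] times the unweighted shift by [(j, a, b)];
    [letcoef] selects the entry named by the first letter of the node. *)
Definition opA_seq j M (h : nat -> 'cV[C]_n) (k : nat) : 'cV[C]_n :=
  if k is k'.+1 then ((kap^-1)%:C%C * letcoef j M (k' %% N)%N) *: h (k' %/ N)%N else 0.

Definition opA j M (h : H) : H := mkl2 (opA_seq j M h).

Let bndA (M : 'M[C]_n) : R := kap ^- 2 * (n%:R * (n%:R * frob2 M)) * N%:R.

Lemma bndA_ge0 M : 0 <= bndA M.
Proof.
apply: mulr_ge0; last exact: ler0n.
apply: mulr_ge0; first by rewrite invr_ge0 sqr_ge0.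
by do 2 (apply: mulr_ge0; first exact: ler0n); apply: frob2_ge0.
Qed.

Lemma psum_opA_seq j M (h : nat -> 'cV[C]_n) K :
  psum (opA_seq j M h) K <= bndA M * psum h K.
Proof.
have h0 k : 0 <= frob2 (h k) by apply: frob2_ge0.
case: K => [|K]; first by rewrite /psum !big_geq // mulr0.
rewrite /psum big_nat_recl // frob20 add0r.
apply: (@le_trans _ _ (kap ^- 2 * (n%:R * (n%:R * frob2 M)) *
   \sum_(0 <= k < K) frob2 (h (k %/ N)%N))).
  rewrite mulr_sumr; apply: ler_sum => k _ /=.
  rewrite frob2Z sqmodM sqmod_real exprVn ler_wpM2r //.
  by rewrite ler_wpM2l ?invr_ge0 ?sqr_ge0 // letcoef_le.
rewrite /bndA -[leRHS]mulrA; apply: ler_wpM2l.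
  apply: mulr_ge0; first by rewrite invr_ge0 sqr_ge0.
  by do 2 (apply: mulr_ge0; first exact: ler0n); apply: frob2_ge0.
apply: (le_trans (sum_divn_le K (nletters_gt0 d n) h0)).
by rewrite ler_wpM2l ?ler0n // (ler_psum_nat h0).
Qed.

Lemma opAE j M h k : opA j M h k = opA_seq j M h k.
Proof.
rewrite /opA (mkl2E (B := bndA M * l2norm2 h)) // => K.
apply: (le_trans (psum_opA_seq _ _ _ _)).
by rewrite ler_wpM2l ?bndA_ge0 // psum_le_l2norm2.
Qed.

Lemma opA_linear j a M1 M2 h : opA j (a *: M1 + M2) h = a *: opA j M1 h + opA j M2 h.
Proof.
apply: l2_inj => k; rewrite l2D l2Z !opAE; case: k => [|k] /=.
  by rewrite scaler0 addr0.
by rewrite letcoefD mulrDr scalerDl scalerA mulrCA.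
Qed.

Lemma opA_bdd j M : bdd_lin (@l2ip R n) (@l2ip R n) (opA j M).
Proof.
apply: (bdd_lin_l2 (bndA_ge0 M)) => [a x y|x].
  apply: l2_inj => k; rewrite l2D l2Z !opAE; case: k => [|k] /=.
    by rewrite scaler0 addr0.
  set s := _ * _; transitivity (s *: (a *: x (k %/ N)%N + y (k %/ N)%N)); first by [].
  by rewrite scalerDr !scalerA [a * _]mulrC.
apply: l2norm2_le => K; have -> : l2val (opA j M x) = opA_seq j M x.
  by apply: funext => k; rewrite opAE.
apply: (le_trans (psum_opA_seq _ _ _ _)).
by rewrite ler_wpM2l ?bndA_ge0 // psum_le_l2norm2.
Qed.

(** The [m] components at one node become the rows of a matrix, so that the coefficient matrices of
    [X] act by left multiplication. *)
Definition mxof m (u : {ffun 'I_m -> H}) (k : nat) : 'M[C]_(m, n) :=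
  \matrix_(p, i) u p k i 0.

Lemma mxof_inj m (u v : {ffun 'I_m -> H}) : (forall k, mxof u k = mxof v k) -> u = v.
Proof.
move=> uv; apply/ffunP => p; apply: l2_inj => k; apply/colP => i.
by have := uv k => /matrixP/(_ p i); rewrite !mxE.
Qed.

Lemma frob2_mxof m (u : {ffun 'I_m -> H}) k : frob2 (mxof u k) = \sum_p frob2 (u p k).
Proof.
rewrite {1}/frob2; apply: eq_bigr => p _; rewrite frob2E.
by apply: eq_bigr => i _; rewrite mxE.
Qed.

Section Resolvent.
Variables (Y : ncpt R d n) (m : nat) (X : ncpt R d (m * n)).
Let x := coords Y X.

(** The entries of the blocks of [X - I (x) Y] are those of [coords], so [LA] is the identity minus
    [step]. Inverting it means solving the tree recursion. *)
Lemma mxof_LA (u : {ffun 'I_m -> H}) k :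
  mxof (LA opA (fun j => X j - ampl m Y j) u) k = mxof u k - step kap x k (mxof u).
Proof.
apply/matrixP => p i; rewrite mxE ffunE l2B l2_sum mxE [RHS]mxE; congr (_ + _).
  by rewrite mxE.
rewrite mxE [RHS]mxE; congr (- _); rewrite summxE.
rewrite (eq_bigr (fun j => \sum_q opA_seq j (blk (X j - ampl m Y j) p q) (u q) k i 0))
   => [|j _]; last first.
  by rewrite l2_sum summxE; apply: eq_bigr => q _; rewrite opAE.
case: k => [|k] /=; first by rewrite [RHS]mxE big1 // => j _; rewrite big1 // => q _; rewrite mxE.
rewrite [RHS]mxE mxE mulr_sumr exchange_big /=; apply: eq_bigr => q _.
rewrite [mxof _ _ _ _]mxE mulrA /letx summxE mulr_sumr mulr_suml; apply: eq_bigr => j _.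
rewrite mxE; congr (_ * _ * _); rewrite /letcoef summxE; apply: eq_bigr => a _.
by rewrite summxE; apply: eq_bigr => b _; rewrite !mxE.
Qed.

Variable rho : R.
Hypotheses (kap0 : 0 < kap) (bx : opbounded x (rho ^+ 2)).
Hypothesis rho_small : 4 * N%:R * rho ^+ 2 <= kap ^+ 2.

Definition res_seq (u : {ffun 'I_m -> H}) (p : 'I_m) (k : nat) : 'cV[C]_n :=
  \col_i sol kap x (mxof u) k p i.

Definition res (u : {ffun 'I_m -> H}) : {ffun 'I_m -> H} :=
  [ffun p => mkl2 (res_seq u p)].

Lemma psum_res_seq u p M : psum (res_seq u p) M <= 4 * \sum_q l2norm2 (u q).
Proof.
apply: (@le_trans _ _ (\sum_(0 <= k < M) frob2 (sol kap x (mxof u) k))).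
  apply: ler_sum => k _; rewrite frob2E /frob2 (bigD1 p) //= -[leLHS]addr0.
  apply: lerD; first by apply: ler_sum => i _; rewrite mxE.
  by apply: sumr_ge0 => *; apply: sumr_ge0 => *; apply: sqmod_ge0.
apply: (le_trans (sol_bound _ kap0 bx rho_small M)); rewrite ler_pM2l //.
under eq_bigr do rewrite frob2_mxof.
by rewrite exchange_big; apply: ler_sum => q _; apply: psum_le_l2norm2.
Qed.

Lemma mxof_res u k : mxof (res u) k = sol kap x (mxof u) k.
Proof.
by apply/matrixP => p i; rewrite mxE ffunE (mkl2E (psum_res_seq u p)) mxE.
Qed.

(** The right inverse is the recursion equation [solE]; the left inverse [res_LA] is the uniqueness
    [sol_uniq]. *)
Lemma LA_res u : LA opA (fun j => X j - ampl m Y j) (res u) = u.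
Proof.
apply: mxof_inj => k; rewrite mxof_LA mxof_res solE.
by rewrite (step_ext _ _ _ (mxof_res u)) addrK.
Qed.

Lemma res_LA u : res (LA opA (fun j => X j - ampl m Y j) u) = u.
Proof.
apply: mxof_inj => k; rewrite mxof_res; symmetry; move: k; apply: sol_uniq => k.
by rewrite mxof_LA subrK.
Qed.

Lemma res_bdd : bdd_lin (ipm (@l2ip R n)) (ipm (@l2ip R n)) res.
Proof.
split=> [a u v|].
  apply: mxof_inj => k.
  have mxofD (w w' : {ffun 'I_m -> H}) l : mxof (a *: w + w') l = a *: mxof w l + mxof w' l.
    by apply/matrixP => p i; rewrite !mxE !ffunE l2D l2Z !mxE.
  apply: etrans (mxof_res _ k) _; apply: etrans _ (esym (mxofD (res u) (res v) k)).
  apply: etrans _ (esym (congr2 (fun S S' => a *: S + S') (mxof_res u k) (mxof_res v k))).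
  (* Linearity follows from uniqueness: the combined solutions solve the recursion with the combined
     source. *)
  symmetry; move: k.
  apply: (@sol_uniq _ _ _ kap _ _ x (mxof (a *: u + v))
    (fun k => a *: sol kap x (mxof u) k + sol kap x (mxof v) k)) => k.
  rewrite (mxofD u v) (solE kap x (mxof u)) (solE kap x (mxof v)) scalerDr addrACA.
  congr (_ + _).
  case: k => [|k] /=; first by rewrite scaler0 addr0.
  by rewrite mulmxDr -scalemxAr scalerDr !scalerA mulrC.
have ipmE (u : {ffun 'I_m -> H}) : ipm (@l2ip R n) u u = (\sum_q l2norm2 (u q))%:C%C.
  by rewrite /ipm rmorph_sum; apply: eq_bigr => q _; rewrite l2ip_self.
exists (Num.sqrt (4 * m%:R)) => u; rewrite !ipmE -rmorphM lecR.
rewrite sqr_sqrtr ?mulr_ge0 ?ler0n // [4 * _]mulrC -mulrA -[X in X%:R * _]card_ord.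
rewrite -sum1_card natr_sum mulr_suml; apply: ler_sum => p _; rewrite mul1r.
by apply: l2norm2_le => M; rewrite ffunE (mkl2E (psum_res_seq u p)) psum_res_seq.
Qed.

End Resolvent.
End StateOperators.

(** The input operator [c]; with such a source at the root the recursion produces [Xi]. *)
Definition init (v : 'cV[C]_n) : H := mkl2 (fun k => if k == 0%N then v else 0).

Lemma psum_init (v : 'cV[C]_n) M : psum (fun k => if k == 0%N then v else 0) M <= frob2 v.
Proof.
rewrite /psum; case: M => [|M]; first by rewrite big_geq ?frob2_ge0.
by rewrite big_nat_recl //= big1 ?addr0 // => k _; rewrite frob20.
Qed.

Lemma initE v k : init v k = if k == 0%N then v else 0.
Proof. by rewrite /init (mkl2E (psum_init v)). Qed.

Lemma init_bdd : bdd_lin (@cip R n) (@l2ip R n) init.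
Proof.
apply: (bdd_lin_cip_l2 ler01) => [a x y|v].
  apply: l2_inj => k; rewrite l2D l2Z !initE.
  by case: eqP => _ //; rewrite scaler0 addr0.
by apply: l2norm2_le => M; rewrite mul1r /init (mkl2E (psum_init v)) psum_init.
Qed.

Section Observation.
Variables (F : nat -> 'M[C]_n) (B : R).
Hypothesis FB : forall M, \sum_(0 <= k < M) frob2 (F k) <= B.

(** The realization uses [b] through its adjoint; the conjugate transpose here makes [b^* h] equal
    to the sum of [F k *m h k]. *)
Definition obs_seq (v : 'cV[C]_n) (k : nat) : 'cV[C]_n :=
  (map_mx Num.conj (F k))^T *m v.

Definition obs (v : 'cV[C]_n) : H := mkl2 (obs_seq v).

Lemma psum_obs v M : psum (obs_seq v) M <= B * frob2 v.
Proof.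
apply: (@le_trans _ _ ((\sum_(0 <= k < M) frob2 (F k)) * frob2 v)); last first.
  by rewrite ler_wpM2r ?frob2_ge0.
rewrite mulr_suml; apply: ler_sum => k _; apply: (le_trans (frob2_mul _ _)).
rewrite frob2_tr; rewrite ler_wpM2r ?frob2_ge0 // le_eqVlt; apply/orP; left.
by apply/eqP; apply: eq_bigr => i _; apply: eq_bigr => j _; rewrite mxE sqmod_conj.
Qed.

Lemma obsE v k : obs v k = obs_seq v k.
Proof. by rewrite /obs (mkl2E (psum_obs v)). Qed.

Lemma obs_bdd : bdd_lin (@cip R n) (@l2ip R n) obs.
Proof.
have B0 : 0 <= B by have := FB 0; rewrite big_geq.
apply: (bdd_lin_cip_l2 B0) => [a x y|v].
  apply: l2_inj => k; rewrite l2D l2Z !obsE /obs_seq.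
  by rewrite mulmxDr scalemxAr.
by apply: l2norm2_le => M; rewrite /obs (mkl2E (psum_obs v)) psum_obs.
Qed.

Lemma adj_obs_cvg (h : H) a :
  ccvg (fun M => \sum_(0 <= k < M) (F k *m h k) a 0) (adj (@l2ip R n) obs h a 0).
Proof.
rewrite mxE; apply: ccvg_ext (l2ip_cvg h _) => M.
rewrite /l2dot; apply: eq_bigr => k _; rewrite obsE /obs_seq -colE mxE.
by apply: eq_bigr => i _; rewrite !mxE conjCK mulrC.
Qed.

End Observation.
End Realization.

(** * Assembly of the realization at [Y] *)

Lemma ubasicW (R : realType) d l (Z : ncpt R d l) (r s : R) k (W : ncpt R d k) :
  r <= s -> ubasic Z r W -> ubasic Z s W.
Proof.
by move=> rs [m [e [m0 H]]]; exists m, e; split=> //; apply: colnorm_ltW H.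
Qed.

Lemma ubasic_coords (R : realType) d n (Y : ncpt R d n) (r : R) m (X : ncpt R d (m * n)) :
  (0 < n)%N -> ubasic Y r X -> (0 < m)%N /\ opbounded (coords Y X) (r ^+ 2).
Proof.
move=> n0 [m' [e [m'0 /colnorm_ltP[s [s0 sr H]]]]].
(* As [0 < n], the size [m * n] determines the multiplicity [m]. *)
have mm' : m' = m by apply/eqP; rewrite -(eqn_pmul2r n0) e.
subst m'; split=> //; have e1 : e = erefl by apply: eq_irrelevance.
subst e; apply: opboundedW (coords_bound (s := s ^+ 2) _) => [|v].
  by rewrite lerXn2r ?nnegrE // ltW // (le_lt_trans s0).
by have := H v; under eq_bigr do rewrite castmx_id.
Qed.

Unset Implicit Arguments.

Theorem mainTheorem13 (R : realType) (d n : nat) (Om : ncset R d) (f : ncfun R d)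
  (Y : ncpt R d n) :
  (0 < n)%N -> ds_closed Om -> is_ncfun Om f -> unif_analytic Om f -> Om n Y ->
  exists (H : lmodType R[i]) (ip : H -> H -> R[i])
         (A : 'I_d -> 'M[R[i]]_n -> H -> H) (b c : 'cV[R[i]]_n -> H) (V : ncset R d),
    [/\ hilbert ip,
        (forall j a (M1 M2 : 'M[R[i]]_n) (h : H),
            A j (a *: M1 + M2) h = a *: A j M1 h + A j M2 h),
        (forall j (M : 'M[R[i]]_n), bdd_lin ip ip (A j M)),
        bdd_lin (@cip R n) ip b & bdd_lin (@cip R n) ip c] /\
    [/\ uopen V, V n Y, (forall k (X : ncpt R d k), V k X -> Om k X) &
        forall m (X : ncpt R d (m * n)), V (m * n)%N X ->
        exists T : {ffun 'I_m -> H} -> {ffun 'I_m -> H},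
          [/\ bdd_lin (ipm ip) (ipm ip) T,
              forall u, LA A (fun j => X j - ampl m Y j) (T u) = u,
              forall u, T (LA A (fun j => X j - ampl m Y j) u) = u &
              forall w : 'cV[R[i]]_(m * n),
                f (m * n)%N X *m w = ampl_out ip b (T (ampl_in c w))]].
Proof.
move=> n0 Ods fnc [Oo Ob] OY.
have [V' [V'o V'Y [c Hc]]] := Ob _ _ OY.
have [r1 r10 H1] := uopen_ball Oo OY; have [r2 r20 H2] := uopen_ball V'o V'Y.
(* On the ball of this radius, membership in [Om] and the bound [c] on [f] hold together. *)
pose r := Num.min r1 r2.
have r0 : 0 < r by rewrite lt_min r10.
have ballO k (W : ncpt R d k) : ubasic Y r W -> Om k W.
  by move=> rW; apply: H1; apply: ubasicW rW; rewrite ge_min lexx.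
have ballf k (W : ncpt R d k) : ubasic Y r W -> opnorm_le (f k W) c.
  move=> rW; apply: Hc (ballO _ _ rW).
  by apply: H2; apply: ubasicW rW; rewrite ge_min lexx orbT.
pose D : R := ((d * n * n).+1)%:R; pose del := r / 2 / D.
have D1 : 1 <= D by rewrite ler1n.
have delE : D * del = r / 2 by rewrite mulrC divfK // gt_eqF // (lt_le_trans ltr01).
(* Coefficients bounded by [del] stay in the ball of radius [r]; [kap] weights the shifts, and [rho]
   is the radius of the neighbourhood of the realization. *)
pose kap := del / 2; pose rho := kap / (2 * (nletters d n)%:R).
have N0 : 0 < 2 * (nletters d n)%:R :> R by rewrite mulr_gt0 ?ltr0n ?nletters_gt0.
have rhoE : rho * (2 * (nletters d n)%:R) = kap by rewrite divfK // gt_eqF.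
have del0 := del_gt0 r0 delE; have kap0 := kap_gt0 r0 delE.
have rho0 := rho_gt0 r0 delE rhoE; have rhoN := rho_kap rhoE.
have rho_le_r : rho <= r.
  have h1 : rho <= kap.
    rewrite ler_pdivrMr // ler_peMr ?(ltW kap0) //.
    by have := nletters_ge1 R d n; lra.
  have h2 : del <= D * del by rewrite ler_peMl // ltW.
  by move: h1 h2; rewrite delE /kap; lra.
pose F := fcoef f Y del.
have FB := fcoef_bound Ods fnc r0 ballO ballf delE.
exists (l2 R n : lmodType R[i]), (@l2ip R n), (opA kap), (obs F), (@init R n), (ubasic Y rho).
split; first split.
- exact: l2_hilbert.
- exact: opA_linear.
- exact: opA_bdd.
- exact: obs_bdd FB.
- exact: init_bdd.
split.
- exact: ubasic_uopen.
- exact: ubasic_id.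
- by move=> k X VX; apply: ballO; apply: ubasicW VX.
move=> m X VX; have [m0 bx] := ubasic_coords n0 VX.
exists (res kap Y X); split.
- exact: res_bdd bx rhoN.
- exact: LA_res bx rhoN.
- exact: res_LA bx rhoN.
(* Entry by entry, both sides are limits of the same partial sums over the nodes. *)
move=> w; apply/colP => t; case: (mxtens_indexP t) => q a.
rewrite [RHS]mxE mxtens_indexK /=.
apply: ccvg_unique (adj_obs_cvg FB _ a).
rewrite mxE sum_mxtens.
pose W : 'M[R[i]]_(m, n) := \matrix_(p, i) w (mxtens_index (p, i)) 0.
(* The input has its only source at the root, so the state at node [k] is [Xi] at [k] applied to [w]
   in block form. *)
have resE k i : res kap Y X (ampl_in (@init R n) w) q k i 0 =
    \sum_p Xi kap (coords Y X) k q p * w (mxtens_index (p, i)) 0.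
  have -> : res kap Y X (ampl_in (@init R n) w) q k i 0 =
      mxof (res kap Y X (ampl_in (@init R n) w)) k q i by rewrite mxE.
  rewrite (mxof_res kap0 bx rhoN).
  have -> : mxof (ampl_in (@init R n) w) = fun k => if k == 0%N then W else 0.
    apply: funext => l; apply/matrixP => p j; rewrite mxE ffunE initE.
    by case: eqP => _; rewrite !mxE.
  by rewrite sol_Xi mxE; apply: eq_bigr => p _; rewrite mxE.
have cv p i : ccvg (fun M => w (mxtens_index (p, i)) 0 *
     (\sum_(0 <= k < M) Xi kap (coords Y X) k q p * F k a i))
   (w (mxtens_index (p, i)) 0 * f _ X (mxtens_index (q, a)) (mxtens_index (p, i))).
  apply: ccvgZ => e e0.
  have [M0 HM0] := f_emb_expansion Ods fnc r0 ballO ballf delE rhoE m0 bx p q a i e0.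
  by exists M0 => M /HM0; rewrite -sqmodN opprB embK.
have := ccvg_sum (index_enum 'I_m) (fun p => ccvg_sum (index_enum 'I_n) (fun i => cv p i)).
rewrite (eq_bigr (fun p => \sum_i f _ X (mxtens_index (q, a)) (mxtens_index (p, i)) *
   w (mxtens_index (p, i)) 0)) => [|p _]; last by apply: eq_bigr => i _; rewrite mulrC.
apply: ccvg_ext => M.
under eq_bigr do under eq_bigr do rewrite mulr_sumr.
rewrite exchange_big [RHS](eq_bigr (fun k => \sum_i \sum_p w (mxtens_index (p, i)) 0 *
   (Xi kap (coords Y X) k q p * F k a i))) => [|k _]; last first.
  rewrite mxE; apply: eq_bigr => i _; rewrite resE mulr_sumr.
  by apply: eq_bigr => p _; ring.
rewrite [RHS]exchange_big /=; apply: eq_bigr => i _.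
by rewrite exchange_big.
Qed.
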